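(* Let $u_0\in L^2([0,1])$ and define $\tilde\tau_{\mathcal B}(u_0)$ by $$h_5(\tilde\tau_{\mathcal B}(u_0))=\frac{m_0^2}{\|H(u_0)-c_0(H(u_0))e_0\|_{L^2}}$$ (with $\tilde\tau_{\mathcal B}(u_0)=0$ if the denominator vanishes). Then for every $t>\tilde\tau_{\mathcal B}(u_0)$ the Koopman decomposition $$\Phi^t_{\mathcal B}(u_0)(x)=\sum_{\nu\in\mathcal{B}}e^{-\lambda_\nu t}\varphi_\nu(u_0)\,a_\nu(x)$$ holds and is absolutely convergent in the sup norm, i.e. $\sum_{\nu\in\mathcal{B}}e^{-\lambda_\nu t}|\varphi_\nu(u_0)|\sup_{x\in[0,1]}|a_\nu(x)|<\infty$. Here, for $\nu=(q_0,\dots,q_m)\in\mathcal{B}$, $$\lambda_\nu=\sum_{i=0}^m(\mu_{q_i}-\mu_0),\qquad \varphi_\nu(u_0)=\prod_{i=0}^m\frac{c_{q_i}(H(u_0))}{c_0(H(u_0))},\qquad a_\nu(x)=2(-1)^{m+1}\frac{\partial_xe_{q_0}(x)}{e_0(x)}\prod_{i=1}^m\frac{e_{q_i}(x)}{e_0(x)}.$$ In particular, for every $\theta_0>0$ the set $$\tilde\Omega_{\mathcal B}(\theta_0)=\Big\{u_0\in L^2([0,1]):\ \|H(u_0)-\tilde f_0\|_{L^2}<\frac{m_0^2}{h_5(\theta_0)}\Big\}$$ is a neighbourhood in $L^2([0,1])$ of $s_0=-2\,\partial_xe_0/e_0$, and for every $u_0\in\tilde\Omega_{\mathcal B}(\theta_0)$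 the Koopman decomposition is absolutely convergent for all $t>\theta_0$.
   Context: $V:[0,1]\to\mathbb{R}$ is a fixed smooth, strictly positive function; $\mathbb{N}=\{0,1,2,\dots\}$. The Burgers flow $\Phi^t_{\mathcal B}$ on $L^2([0,1])$ is defined by $\Phi^t_{\mathcal B}(u_0)=u(t,\cdot)$, where $u$ is the solution (continuous in $t\ge0$ with values in $L^2([0,1])$, infinitely differentiable in $x$ and satisfying the equation and boundary conditions classically for $t>0$) of $$\partial_tu+u\,\partial_xu=\partial^2_{xx}u+2\partial_xV,\qquad u(t,0)=u(t,1)=0,\qquad u(0,x)=u_0(x).$$ The operator $A=-\partial^2_{xx}+V$ on $[0,1]$ with Neumann boundary conditions is self-adjoint, with eigenvalues $0<\mu_0<\mu_1\le\mu_2\le\dots$ and a complete orthonormal family $(e_n)_{n\in\mathbb{N}}$ in $L^2([0,1])$ of real eigenfunctions: $-\partial_{xx}^2e_n+Ve_n=\mu_ne_n$, $\partial_xe_n(0)=\partial_xe_n(1)=0$; $e_0$ is chosen with $e_0>0$ on $[0,1]$, and $m_0=\inf_{[0,1]}e_0>0$. Put $c_n(v)=\int_0^1e_n(x)v(x)\,dx$ and $\tilde f_0=e_0/\int_0^1e_0(\xi)d\xi$. The Cole-Hopf transform is $$H(u)(x)=\frac{e^{-\frac12\int_0^xu(s)ds}}{\int_0^1e^{-\frac12\int_0^yu(s)ds}dy},\qquad u\in L^2([0,1]).$$ Index set: $\mathcal{B}=\bigcup_{m=0}^\infty\mathcal{B}_m$ with $\mathcal{B}_m=\{(q_0,\dots,q_m):q_0\in\mathbb{N},\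 q_i\in\mathbb{N}\setminus\{0\}\text{ for }i=1,\dots,m\}$; empty products equal $1$. Set $$h_5(t)=\sqrt{\sum_{q=1}^\infty e^{-2(\mu_q-\mu_0)t}(1+\sqrt{\mu_q})^2},\qquad t>0,$$ a continuous decreasing bijection from $]0,\infty[$ onto $]0,\infty[$. *)

(* Defs.v *)
From HB Require Import structures.
From mathcomp Require Import all_boot all_order all_algebra.
From mathcomp Require Import all_classical all_reals all_analysis.

Set Implicit Arguments.
Unset Strict Implicit.
Unset Printing Implicit Defensive.

Import Order.TTheory GRing.Theory Num.Theory.
Import numFieldTopology.Exports numFieldNormedType.Exports.

Local Open Scope classical_set_scope.
Local Open Scope ring_scope.

(* Functions on [0,1] are represented by functions R -> R; every notion below
   depends only on their values on [0,1]. *)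

Section UnitInterval.
Context {R : realType}.
Implicit Types (f g : R -> R) (x y : R).

Definition I01 : set R := `[0, 1].

(* Derivative relative to [0,1]: one-sided at the endpoints. *)
Definition derivable01 f x : Prop :=
  cvg ((f y - f x) / (y - x) @[y --> within I01 x^']).

Definition derive01 f x : R :=
  lim ((f y - f x) / (y - x) @[y --> within I01 x^']).

Definition smooth01 f : Prop :=
  forall n x, I01 x -> derivable01 (iter n derive01 f) x.

(* L^2([0,1]); its elements are represented by functions, not by classes. *)
Definition L2 : set (R -> R) :=
  [set f : R -> R | (f \_ I01 : R -> R) \in Lfun (@lebesgue_measure R) 2%:E].

Definition L2norm f : R :=
  fine ('N[@lebesgue_measure R]_2%:E [EFin \o (f \_ I01)]).

Definition int01 f : R := \int[@lebesgue_measure R]_(x in I01) f x.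

Definition L2_neighbourhood (s : R -> R) (A : set (R -> R)) : Prop :=
  L2 s /\ exists2 delta : R, 0 < delta &
    forall v, L2 v -> L2norm (v \- s) < delta -> A v.

End UnitInterval.

(* The Burgers flow: Phi^t(u0) = u t for the solution u with datum u0. *)
Section Burgers.
Context {R : realType}.
Variable V : R -> R.

(* [c0], [c1], [c2], [ct] express that the derivatives occurring in the equation
   are continuous in (t, x), as usual for classical solutions. *)
Record burgers_solution (u0 : R -> R) (u : R -> R -> R) : Prop := {
  burgers_L2 : forall t : R, 0 <= t -> L2 (u t) ;
  burgers_cvg : forall t : R, 0 <= t ->
    L2norm (u s \- u t) @[s --> within [set s : R | 0 <= s] (nbhs t)] --> (0 : R) ;
  burgers_init : {ae @lebesgue_measure R, forall x, I01 x -> u 0 x = u0 x} ;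
  burgers_smooth : forall t : R, 0 < t -> smooth01 (u t) ;
  burgers_c0 : {within `]0, +oo[ `*` I01, continuous (fun p : R * R => u p.1 p.2)} ;
  burgers_c1 : {within `]0, +oo[ `*` I01,
    continuous (fun p : R * R => derive01 (u p.1) p.2)} ;
  burgers_c2 : {within `]0, +oo[ `*` I01,
    continuous (fun p : R * R => derive01 (derive01 (u p.1)) p.2)} ;
  burgers_dt : forall t x : R, 0 < t -> I01 x -> derivable (u ^~ x) t 1 ;
  burgers_ct : {within `]0, +oo[ `*` I01,
    continuous (fun p : R * R => derive1 (u ^~ p.2) p.1)} ;
  burgers_eq : forall t x : R, 0 < t -> I01 x ->
    derive1 (u ^~ x) t + u t x * derive01 (u t) x
      = derive01 (derive01 (u t)) x + 2 * derive01 V x ;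
  burgers_bc : forall t : R, 0 < t -> u t 0 = 0 /\ u t 1 = 0
}.

(* Eigenvalues and eigenfunctions of - d^2/dx^2 + V with Neumann conditions. *)
Record neumann_eigensystem (mu : nat -> R) (e : nat -> R -> R) : Prop := {
  eigenval_gt0 : 0 < mu 0%N ;
  eigenval_simple : mu 0%N < mu 1%N ;
  eigenval_ndecr : forall n, mu n <= mu n.+1 ;
  eigenfun_d1 : forall n x, I01 x -> derivable01 (e n) x ;
  eigenfun_d2 : forall n x, I01 x -> derivable01 (derive01 (e n)) x ;
  eigenfun_eq : forall n x, I01 x ->
    - derive01 (derive01 (e n)) x + V x * e n x = mu n * e n x ;
  eigenfun_bc : forall n, derive01 (e n) 0 = 0 /\ derive01 (e n) 1 = 0 ;
  eigenfun_orthonormal : forall m n,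
    int01 (fun x => e m x * e n x) = (m == n)%:R ;
  eigenfun_complete : forall v, L2 v ->
    L2norm (fun x => v x - \sum_(k < n) int01 (fun y => e k y * v y) * e k x)
      @[n --> \oo] --> (0 : R) ;
  eigenfun0_gt0 : forall x, I01 x -> 0 < e 0%N x
}.

End Burgers.

Section Koopman.
Context {R : realType}.
Variables (mu : nat -> R) (e : nat -> R -> R).

Definition coef (n : nat) (v : R -> R) : R := int01 (fun x => e n x * v x).

Definition m0 : R := inf [set e 0%N x | x in I01].

Definition f0 (x : R) : R := e 0%N x / int01 (e 0%N).

Definition s0 (x : R) : R := - 2 * derive01 (e 0%N) x / e 0%N x.

Definition cole_hopf_num (u : R -> R) (x : R) : R :=
  expR (- (2^-1 * \int[@lebesgue_measure R]_(s in `[0, x]) u s)).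

Definition cole_hopf (u : R -> R) (x : R) : R :=
  cole_hopf_num u x / int01 (cole_hopf_num u).

Definition h5 (t : R) : R :=
  Num.sqrt (fine (\sum_(1 <= q <oo)
    (expR (- (2 * (mu q - mu 0%N) * t)) * (1 + Num.sqrt (mu q)) ^+ 2)%:E)%E).

Definition koopman_defect (u0 : R -> R) : R :=
  L2norm (fun x =>
    cole_hopf u0 x - coef 0 (cole_hopf u0) * e 0%N x).

(* [h5] is a bijection of ]0, +oo[, so [xget] selects the unique solution. *)
Definition koopman_time (u0 : R -> R) : R :=
  if koopman_defect u0 == 0 then 0
  else xget 0 [set tau : R | 0 < tau /\ h5 tau = m0 ^+ 2 / koopman_defect u0].

Definition koopman_domain (theta0 : R) : set (R -> R) :=
  [set u0 | L2 u0 /\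
    L2norm (cole_hopf u0 \- f0) < m0 ^+ 2 / h5 theta0].

(* (q_0, [:: q_1; ...; q_m]) stands for the multi-index (q_0, ..., q_m). *)
Definition koopman_index : set (nat * seq nat) :=
  [set nu | forall q, q \in nu.2 -> (0 < q)%N].

Implicit Type nu : nat * seq nat.

Definition koopman_lambda nu : R := \sum_(q <- nu.1 :: nu.2) (mu q - mu 0%N).

Definition koopman_phi nu (u0 : R -> R) : R :=
  \prod_(q <- nu.1 :: nu.2) (coef q (cole_hopf u0) / coef 0 (cole_hopf u0)).

Definition koopman_mode nu (x : R) : R :=
  2 * (-1) ^+ (size nu.2).+1 * (derive01 (e nu.1) x / e 0%N x)
    * \prod_(q <- nu.2) (e q x / e 0%N x).

Definition koopman_abs_cvg (u0 : R -> R) (t : R) : Prop :=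
  (\esum_(nu in koopman_index)
     ((expR (- (koopman_lambda nu * t)) * `|koopman_phi nu u0|)%:E
      * ereal_sup [set (`|koopman_mode nu x|)%:E | x in I01]) < +oo)%E.

End Koopman.

(* Unordered sum: convergence along the finite subsets of D. *)
Definition has_sum {R : realType} {T : choiceType} (D : set T) (f : T -> R)
    (l : R) : Prop :=
  forall eps : R, 0 < eps -> exists2 A0, fsets D A0 &
    forall A, fsets D A -> A0 `<=` A -> `|l - \sum_(i \in A) f i| < eps.

Definition koopman_decomposition {R : realType} (V : R -> R) (mu : nat -> R)
    (e : nat -> R -> R) (u0 : R -> R) (t : R) : Prop :=
  koopman_abs_cvg mu e u0 t /\
  forall u, burgers_solution V u0 u -> forall x, I01 x ->
    has_sum koopman_index
      (fun nu => expR (- (koopman_lambda mu nu * t)) * koopman_phi e nu u0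
                   * koopman_mode e nu x)
      (u t x).

(* Main.v *)
(** The Cole-Hopf function [phi = exp (-1/2 int_0^x u)] of a Burgers solution
    satisfies [phi_t = phi_xx - V phi + g(t) phi] with Neumann conditions, so the
    ratios [c_n(phi) / c_0(phi)] decay exactly like [exp (- (mu_n - mu_0) t)].
    Applying completeness to [phi_xx - V phi] shows that the eigenfunction
    expansions of [phi] and of [phi_x] both converge uniformly; dividing them,
    [u = - 2 phi_x / phi] becomes [- 2 D / (1 + z)], where [z] sums the terms
    [exp (- (mu_q - mu_0) t) c_q e_q / (c_0 e_0)] over [q >= 1].  The one-dimensional
    Sobolev bound [|f| <= |f|_2 + |f'|_2] gives [|e_q| <= 1 + sqrt mu_q], and with
    [c_0 >= m_0] and Cauchy-Schwarz one gets
    [|z| <= h5(t) |H(u0) - c_0 e_0|_2 / m_0^2 < 1], so that the geometric series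
    for [1 / (1 + z)], expanded into words in [q], is the Koopman decomposition.
    The same Sobolev bound tested on the resolvent kernel yields
    [sum_q 1 / (1 + mu_q) <= 2], whence all heat series converge. *)

Require Import Defs.
From mathcomp Require Import all_boot all_order all_algebra.
From mathcomp Require Import all_classical all_reals all_analysis.
From mathcomp Require Import lra zify.
Import Order.TTheory GRing.Theory Num.Theory.
Import numFieldTopology.Exports numFieldNormedType.Exports.
Local Open Scope classical_set_scope.
Local Open Scope ring_scope.
Set Implicit Arguments.
Unset Strict Implicit.
Unset Printing Implicit Defensive.

(** * Integrals and the L2 norm on [0,1] *)

(** The Cole-Hopf function is normalised to 1 at x = 0 rather than by its integral. This makes it
    explicit, at the price of the factor g(t), half the flux of [u] at x = 0. That factor is the
    same for every mode, so it cancels in ratios to c_0 and is never computed. The equation holds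
    for t > 0 only and the datum is attained in L^2 only, so the ratios conserved on ]0, +oo[ have
    to be carried to t = 0; a comparison of Cole-Hopf functions by multiplicative factors does this,
    and it also yields the neighbourhood of [s0]. A multi-index is a head q_0 with a word (q_1, ...,
    q_m). The heads are summable for every t > 0; only the words need the smallness condition. On
    finite boxes of indices the sum factorises into a sum over heads and a finite geometric series.
    A summable majorant independent of x then makes the result independent of the exhaustion and
    gives convergence in the sup norm. The threshold is a genuine solution of its equation because
    h5^2 is strictly decreasing, Lipschitz away from 0, and takes arbitrarily large and arbitrarily
    small values. *)

Definition continuous01 {R : realType} (f : R -> R) : Prop :=
  {within I01, continuous f}.

Definition integrable01 {R : realType} (f : R -> R) : Prop :=
  (@lebesgue_measure R).-integrable I01 (EFin \o f).

Definition primitive {R : realType} (f : R -> R) (x : R) : R :=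
  \int[@lebesgue_measure R]_(s in `[0, x]) f s.

(** Common source of the Cauchy-Schwarz inequalities for integrals and for finite sums. For C = 0
    the polynomial is affine, which forces B = 0; otherwise it is evaluated at its minimum - B /
    C. *)
Lemma discriminant_le0 {R : realFieldType} (A B C : R) :
  0 <= C -> (forall k, 0 <= A + k * (2 * B) + k ^+ 2 * C) -> B ^+ 2 <= A * C.
Proof.
move=> C0 H.
have [C0'|C0'] := eqVneq C 0.
  have [->|B0] := eqVneq B 0; first by rewrite C0' expr0n mulr0.
  (* With C = 0 and B nonzero, this k gives the value -1. *)
  have := H (- (A + 1) / (2 * B)).
  rewrite C0' => h; exfalso; move: h; rewrite leNgt => /negP; apply.
  suff -> : - (A + 1) / (2 * B) * (2 * B) = - (A + 1) by lra.
  by rewrite -mulrA mulVf ?mulr1// mulf_neq0.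
have := H (- B / C).
have Cp : 0 < C by rewrite lt_def C0'.
rewrite -(pmulr_rge0 _ Cp).
have -> : C * (A + - B / C * (2 * B) + (- B / C) ^+ 2 * C)
  = C * A + - (C / C * B * (2 * B)) + (C / C) ^+ 2 * B ^+ 2 by lra.
rewrite divff//; lra.
Qed.

Section IntegralsOnI01.
Context {R : realType}.
Implicit Types (f g : R -> R) (x y k : R).
Notation mu := (@lebesgue_measure R).

Lemma I01E x : I01 x <-> 0 <= x <= 1.
Proof. by rewrite /I01 /= in_itv. Qed.

Lemma I01_0 : I01 (0 : R). Proof. by apply/I01E; rewrite lexx ler01. Qed.
Lemma I01_1 : I01 (1 : R). Proof. by apply/I01E; rewrite lexx ler01. Qed.

Lemma measurable_I01 : @measurable _ (measurableTypeR R) I01.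
Proof. exact: measurable_itv. Qed.
Hint Resolve measurable_I01 : core.

Lemma continuous01P f : continuous01 f <->
  forall x, I01 x -> f y @[y --> within I01 (nbhs x)] --> f x.
Proof. exact: subspace_continuousP. Qed.

Lemma continuous01_cst k : continuous01 (cst k).
Proof. by apply/continuous01P => x _; exact: cvg_cst. Qed.

Lemma continuous01D f g :
  continuous01 f -> continuous01 g -> continuous01 (fun x => f x + g x).
Proof.
move=> /continuous01P cf /continuous01P cg; apply/continuous01P => x Ix.
by apply: cvgD; [exact: cf|exact: cg].
Qed.

Lemma continuous01M f g :
  continuous01 f -> continuous01 g -> continuous01 (fun x => f x * g x).
Proof.
move=> /continuous01P cf /continuous01P cg; apply/continuous01P => x Ix.
by apply: cvgM; [exact: cf|exact: cg].
Qed.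

Lemma continuous01Z k f : continuous01 f -> continuous01 (fun x => k * f x).
Proof. by move=> cf; apply: continuous01M => //; exact: continuous01_cst. Qed.

Lemma continuous01B f g :
  continuous01 f -> continuous01 g -> continuous01 (fun x => f x - g x).
Proof.
move=> /continuous01P cf /continuous01P cg; apply/continuous01P => x Ix.
by apply: cvgB; [exact: cf|exact: cg].
Qed.

Lemma continuous01V f : continuous01 f -> (forall x, I01 x -> f x != 0) ->
  continuous01 (fun x => (f x)^-1).
Proof.
move=> /continuous01P cf f0; apply/continuous01P => x Ix.
by apply: cvgV; [exact: f0|exact: cf].
Qed.

Lemma continuous01_comp f g : continuous g -> continuous01 f ->
  continuous01 (g \o f).
Proof.
move=> cg /continuous01P cf; apply/continuous01P => x Ix.
exact: (cvg_comp _ _ (cf x Ix) (cg (f x))).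
Qed.

Lemma continuous01_sum n (F : nat -> R -> R) :
  (forall i, continuous01 (F i)) -> continuous01 (fun x => \sum_(i < n) F i x).
Proof.
move=> cF; elim: n => [|n ih].
  by under eq_fun do rewrite big_ord0; exact: continuous01_cst.
by under eq_fun do rewrite big_ord_recr /=; exact: continuous01D.
Qed.

Lemma eq_continuous01 f g : (forall x, I01 x -> f x = g x) ->
  continuous01 f -> continuous01 g.
Proof.
by move=> fg; apply: subspace_eq_continuous => x /set_mem Ix; exact: fg.
Qed.

Lemma continuous01_bounded f : continuous01 f ->
  exists2 M : R, 0 < M & forall x, I01 x -> `|f x| <= M.
Proof.
move=> cf.
have cnf : continuous01 (fun x => `|f x|).
  by apply: (continuous01_comp (g := fun y => `|y|)) => //; exact: norm_continuous.
have [c _ cP] := EVT_max ler01 cnf.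
exists (`|f c| + 1); first by rewrite ltr_wpDl.
by move=> x Ix; rewrite (le_trans (cP x _)) ?lerDl// inE.
Qed.

Lemma continuous01_integrable f : continuous01 f -> integrable01 f.
Proof.
by move=> cf; apply: continuous_compact_integrable => //; exact: segment_compact.
Qed.

Lemma integrable01D f g : integrable01 f -> integrable01 g ->
  integrable01 (fun x => f x + g x).
Proof. by move=> cf cg; exact: (integrableD measurable_I01 cf cg). Qed.

Lemma integrable01Z k f : integrable01 f -> integrable01 (fun x => k * f x).
Proof. by move=> cf; exact: (integrableZl measurable_I01 k cf). Qed.

Lemma eq_int01 f g : (forall x, I01 x -> f x = g x) -> int01 f = int01 g.
Proof. by move=> fg; apply: eq_Rintegral => x /set_mem; exact: fg. Qed.

Lemma int01D f g : integrable01 f -> integrable01 g ->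
  int01 (fun x => f x + g x) = int01 f + int01 g.
Proof. by move=> ? ?; exact: RintegralD. Qed.

Lemma int01Z k f : integrable01 f -> int01 (fun x => k * f x) = k * int01 f.
Proof. by move=> ?; exact: RintegralZl. Qed.

Lemma int01B f g : integrable01 f -> integrable01 g ->
  int01 (fun x => f x - g x) = int01 f - int01 g.
Proof. by move=> ? ?; exact: RintegralB. Qed.

Lemma int01_cst k : int01 (cst k) = k.
Proof.
rewrite /int01 /Rintegral /cst integral_cst//= /I01 lebesgue_measure_itv/=.
by rewrite lte_fin ltr01 sube0 mule1.
Qed.

Lemma integrable01_sum n (F : nat -> R -> R) :
  (forall i, integrable01 (F i)) ->
  integrable01 (fun x => \sum_(i < n) F i x).
Proof.
move=> iF; elim: n => [|n ih].
  under eq_fun do rewrite big_ord0.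
  by apply: continuous01_integrable; exact: continuous01_cst.
by under eq_fun do rewrite big_ord_recr /=; exact: integrable01D.
Qed.

Lemma int01_sum n (F : nat -> R -> R) : (forall i, integrable01 (F i)) ->
  int01 (fun x => \sum_(i < n) F i x) = \sum_(i < n) int01 (F i).
Proof.
move=> iF; elim: n => [|n ih].
  by rewrite big_ord0 -[RHS](int01_cst 0); apply: eq_int01 => x _; rewrite big_ord0.
rewrite big_ord_recr /= -ih -int01D//; last exact: integrable01_sum.
by apply: eq_int01 => x _; rewrite big_ord_recr.
Qed.

Lemma int01_ge0 f : (forall x, I01 x -> 0 <= f x) -> 0 <= int01 f.
Proof. by move=> h; apply: Rintegral_ge0. Qed.

Lemma le_int01 f g : integrable01 f -> integrable01 g ->
  (forall x, I01 x -> f x <= g x) -> int01 f <= int01 g.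
Proof. by move=> ? ? ?; exact: le_Rintegral. Qed.

Lemma L2_integrable_sqr f : L2 f -> integrable01 (fun x => f x ^+ 2).
Proof.
move=> /Lfun2_integrable_sqr h.
suff : mu.-integrable setT ((EFin \o (fun x => f x ^+ 2)) \_ I01).
  by move/(integrable_restrict mu measurable_I01 measurableT) ; rewrite setTI.
apply: eq_integrable h => // x _ /=.
rewrite /patch; case: ifPn => _ //=.
by rewrite expr0n.
Qed.

Lemma L2_integrableM f g : L2 f -> L2 g -> integrable01 (fun x => f x * g x).
Proof.
move=> lf lg; have /Lfun1_integrable h := Lfun2_mul_Lfun1 lf lg.
suff : mu.-integrable setT ((EFin \o (fun x => f x * g x)) \_ I01).
  by move/(integrable_restrict mu measurable_I01 measurableT) ; rewrite setTI.
apply: eq_integrable h => // x _ /=.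
rewrite /patch; case: ifPn => _ //=.
by rewrite mul0r.
Qed.

Lemma continuous01_L2 f : continuous01 f -> L2 f.
Proof.
move=> cf; have [M M0 fM] := continuous01_bounded cf.
have mf0 : measurable_fun (I01 : set (measurableTypeR R)) f.
  by move/continuous01_integrable : cf => /measurable_int /measurable_realfun.measurable_EFinP.
have mf : measurable_fun setT (f \_ I01) by apply/(measurable_restrictT _ _).1.
rewrite /L2 /= inE; apply/andP; split; rewrite inE//=.
rewrite /finite_norm unlock /= poweR_lty//.
have -> : (fun x => (`|(f \_ I01) x| `^ 2)%:E) = ((fun x => (`|f x| `^ 2)%:E) \_ I01).
  apply/funext => x; rewrite !patchE; case: ifP => //= _.
  by rewrite normr0 powR0.
rewrite -integral_mkcond.
have : (\int[mu]_(x in I01) (`|f x| `^ 2)%:E <= \int[mu]_(x in I01) (M ^+ 2)%:E)%E.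
  apply: ge0_le_integral => //.
  - apply/measurable_realfun.measurable_EFinP.
    apply: (@measurableT_comp _ _ _ _ _ _ (fun x : R => x `^ 2)) => //.
    exact: measurableT_comp.
  move=> x Ix; rewrite lee_fin powR_mulrn//.
  by rewrite lerXn2r ?nnegrE ?fM// ltW.
move/le_lt_trans; apply.
by rewrite integral_cst//= /I01 lebesgue_measure_itv/= lte_fin ltr01 sube0 mule1 ltry.
Qed.

Lemma L2D f g : L2 f -> L2 g -> L2 (fun x => f x + g x).
Proof.
rewrite /L2 /= => lf lg.
have -> : (fun x => f x + g x) \_ I01 = f \_ I01 + g \_ I01 :> (R -> R).
  by apply/funext => x; rewrite /patch fctE; case: ifP => //; rewrite addr0.
have p1 : (1 <= 2%:E :> \bar R)%E by rewrite lee_fin ler1n.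
exact: (Lfun_addr_closed mu p1).2.
Qed.

Lemma L2Z k f : L2 f -> L2 (fun x => k * f x).
Proof.
rewrite /L2 /= => lf.
have -> : (fun x => k * f x) \_ I01 = k \o* (f \_ I01) :> (R -> R).
  apply/funext => x; rewrite /patch /=; case: ifP => // _; last by rewrite mul0r.
  by rewrite mulrC.
by apply: Lfun_scale => //; rewrite ler1n.
Qed.

Lemma L2B f g : L2 f -> L2 g -> L2 (fun x => f x - g x).
Proof.
move=> lf lg; have := L2D lf (L2Z (-1) lg).
by under eq_fun do rewrite mulN1r.
Qed.

Lemma L2_integrable f : L2 f -> integrable01 f.
Proof.
move=> lf; have := L2_integrableM lf (continuous01_L2 (@continuous01_cst 1)).
by under eq_fun do rewrite mulr1.
Qed.

Lemma L2norm_ge0 f : 0 <= L2norm f.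
Proof. by rewrite /L2norm fine_ge0// Lnorm_ge0. Qed.

(** Link between the extended-real norm and [int01]: membership in [L2] makes the norm finite, so
    [fine] commutes with squaring. *)
Lemma L2norm_sqr f : L2 f -> L2norm f ^+ 2 = int01 (fun x => f x ^+ 2).
Proof.
move=> lf; have := lf; rewrite /L2/= inE => /andP[_]; rewrite inE /= /finite_norm => fin.
have finN : 'N[mu]_2%:E[EFin \o f \_ I01]%E \is a fin_num.
  by rewrite ge0_fin_numE// Lnorm_ge0.
rewrite /L2norm -powR_mulrn ?fine_ge0 ?Lnorm_ge0//.
have -> : fine 'N[mu]_2%:E[EFin \o f \_ I01] `^ 2 =
    fine ('N[mu]_2%:E[EFin \o f \_ I01] `^ 2)%E.
  by rewrite -(fineK finN).
rewrite powR_Lnorm// /int01 Rintegral_mkcond; congr fine.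
apply: eq_integral => x _ /=.
rewrite /patch; case: ifP => _; last by rewrite normr0 powR0.
by rewrite powR_mulrn// real_normK// num_real.
Qed.

Lemma eq_L2norm f g : (forall x, I01 x -> f x = g x) -> L2norm f = L2norm g.
Proof.
move=> fg; congr (fine ('N[mu]_2%:E[EFin \o _]%E)); apply/funext => x.
by rewrite /patch; case: ifPn => // /set_mem /fg.
Qed.

Lemma cauchy_schwarz01 f g : L2 f -> L2 g ->
  `|int01 (fun x => f x * g x)| <= L2norm f * L2norm g.
Proof.
move=> lf lg.
rewrite -ler_sqr ?nnegrE ?mulr_ge0 ?L2norm_ge0// exprMn !L2norm_sqr//.
rewrite real_normK ?num_real//.
set A := int01 (fun x => f x ^+ 2); set C := int01 (fun x => g x ^+ 2).
set B := int01 _.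
have H k : 0 <= A + k * (2 * B) + k ^+ 2 * C.
  suff -> : A + k * (2 * B) + k ^+ 2 * C = int01 (fun x => (f x + k * g x) ^+ 2).
    by apply: int01_ge0 => x _; exact: sqr_ge0.
  rewrite /A /B /C.
  have i1 := L2_integrable_sqr lf; have i2 := L2_integrable_sqr lg.
  have i3 := L2_integrableM lf lg.
  rewrite -int01Z// -int01Z; last exact: integrable01Z.
  rewrite -int01Z// -int01D//; last by do 2 apply: integrable01Z.
  rewrite -int01D//; last 2 first.
  - by apply: integrable01D => //; do 2 apply: integrable01Z.
  - exact: integrable01Z.
  by apply: eq_int01 => x _; lra.
apply: discriminant_le0 H; apply: int01_ge0 => x _; exact: sqr_ge0.
Qed.

Lemma L2norm_le f k : L2 f -> 0 <= k -> int01 (fun x => f x ^+ 2) <= k ^+ 2 ->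
  L2norm f <= k.
Proof.
by move=> lf k0; rewrite -L2norm_sqr// ler_sqr// nnegrE L2norm_ge0.
Qed.

Lemma L2normD f g : L2 f -> L2 g ->
  L2norm (fun x => f x + g x) <= L2norm f + L2norm g.
Proof.
move=> lf lg; apply: L2norm_le; [exact: L2D|by rewrite addr_ge0 ?L2norm_ge0|].
have i1 := L2_integrable_sqr lf; have i2 := L2_integrable_sqr lg.
have i3 := L2_integrableM lf lg.
have -> : int01 (fun x => (f x + g x) ^+ 2) =
   int01 (fun x => f x ^+ 2) + 2 * int01 (fun x => f x * g x)
     + int01 (fun x => g x ^+ 2).
  rewrite -int01Z// -int01D//; last exact: integrable01Z.
  rewrite -int01D//; last by apply: integrable01D => //; exact: integrable01Z.
  by apply: eq_int01 => x _; lra.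
rewrite -!L2norm_sqr//.
have := cauchy_schwarz01 lf lg; move: (int01 _) => B /ler_normlW; lra.
Qed.

Lemma L2normZ k f : L2 f -> L2norm (fun x => k * f x) = `|k| * L2norm f.
Proof.
move=> lf; apply/eqP; rewrite -(eqrXn2 (n:=2)) ?mulr_ge0 ?L2norm_ge0//; apply/eqP.
rewrite exprMn !L2norm_sqr//; last exact: L2Z.
rewrite real_normK ?num_real// -int01Z; last exact: L2_integrable_sqr.
by apply: eq_int01 => x _; rewrite exprMn.
Qed.

Lemma L2norm_bounded f k : L2 f -> 0 <= k ->
  (forall x, I01 x -> `|f x| <= k) -> L2norm f <= k.
Proof.
move=> lf k0 fk; apply: L2norm_le => //.
rewrite -[leRHS]int01_cst; apply: le_int01.
- exact: L2_integrable_sqr.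
- by apply: continuous01_integrable; exact: continuous01_cst.
- by move=> x Ix; rewrite -(real_normK (num_real (f x))) lerXn2r ?nnegrE ?fk.
Qed.

Lemma L2norm_le_pointwise f g : L2 f -> L2 g ->
  (forall x, I01 x -> `|f x| <= `|g x|) -> L2norm f <= L2norm g.
Proof.
move=> lf lg fg; apply: L2norm_le => //; first exact: L2norm_ge0.
rewrite L2norm_sqr//; apply: le_int01; [exact: L2_integrable_sqr..|].
move=> x Ix; rewrite -(real_normK (num_real (f x))) -(real_normK (num_real (g x))).
by rewrite lerXn2r ?nnegrE ?fg.
Qed.

Lemma subset_0x x : I01 x -> `[0, x] `<=` (I01 : set R).
Proof.
move=> /I01E/andP[_ x1] y /=; rewrite /I01/= !in_itv/= => /andP[-> /=].
by move=> /le_trans; exact.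
Qed.

Lemma primitive0 f : primitive f 0 = 0.
Proof. by rewrite /primitive set_itv1 Rintegral_set1. Qed.

(** The integral of |f| over ]x, y] is at most its integral over [0,1], which Cauchy-Schwarz against
    the constant 1 bounds by the L2 norm. *)
Lemma le_norm_primitiveB f x y : L2 f -> I01 x -> I01 y ->
  `|primitive f y - primitive f x| <= L2norm f.
Proof.
move=> lf; wlog xy : x y / x <= y.
  move=> h Ix Iy; have [xy|/ltW yx] := leP x y; first exact: h.
  by rewrite distrC; exact: h.
move=> Ix Iy.
have if1 : mu.-integrable `[0, y] (EFin \o f).
  by apply: integrableS (L2_integrable lf) => //; exact: subset_0x.
move: (Ix) (Iy) => /I01E /andP[x0 x1] /I01E /andP[y0 y1].
rewrite /primitive (@Rintegral_itvB _ f (BLeft 0) (BRight y) x)//.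
have sub : `]x, y] `<=` (I01 : set R).
  move=> z /=; rewrite /I01/= !in_itv/= => /andP[xz zy].
  by rewrite (le_trans x0 (ltW xz)) (le_trans zy y1).
rewrite (le_trans (le_normr_Rintegral _ _))//.
  exact: integrableS (L2_integrable lf).
have inf : integrable01 (fun x => `|f x|).
  have := integrable_norm (L2_integrable lf); exact.
apply: (@le_trans _ _ (int01 (fun x => `|f x|))).
  rewrite [leLHS](_ : _ = int01 ((fun x => `|f x|) \_ `]x, y])); last first.
    by rewrite /int01 -[in RHS]Rintegral_mkcondr setIidr.
  apply: le_int01 => //.
    have := integrable_restrict mu (measurable_itv `]x, y]) measurable_I01 (EFin \o (fun x => `|f x|)).
    rewrite setIidr// restrict_EFin => h; apply/h.
    exact: integrableS inf.
  by move=> z _; rewrite /patch; case: ifP => _ //=; exact: normr_ge0.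
have ln : L2 (fun x => `|f x|).
  move: lf; rewrite /L2 /= !inE => /andP[]; rewrite !inE/= => mf fin.
  have nE : (fun x => `|f x|) \_ I01 = (fun x => `|(f \_ I01) x|).
    by apply/funext => z; rewrite /patch; case: ifP => //; rewrite normr0.
  apply/andP; split; rewrite inE/= nE; first exact: measurableT_comp.
  move: fin; rewrite /finite_norm -Lnorm_abse.
  by under [X in (_ < _ -> Lnorm _ _ X < _)%E]eq_fun do [].
have := cauchy_schwarz01 ln (continuous01_L2 (@continuous01_cst 1)).
rewrite (eq_int01 (g := fun x => `|f x|)); last by move=> z _; rewrite mulr1.
rewrite ger0_norm; last by apply: int01_ge0.
move/le_trans; apply.
rewrite -[leRHS]mulr1.
apply: ler_pM; rewrite ?L2norm_ge0//.
  apply: L2norm_le => //; first exact: L2norm_ge0.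
  rewrite L2norm_sqr// le_eqVlt; apply/orP; left; apply/eqP.
  by apply: eq_int01 => z _; rewrite real_normK// num_real.
apply: L2norm_bounded => //; first exact: (continuous01_L2 (@continuous01_cst 1)).
by move=> z _; rewrite normr1.
Qed.

Lemma le_norm_primitive f x : L2 f -> I01 x -> `|primitive f x| <= L2norm f.
Proof.
by move=> lf Ix; have := le_norm_primitiveB lf I01_0 Ix; rewrite primitive0 subr0.
Qed.

Lemma primitive_continuous f : integrable01 f -> continuous01 (primitive f).
Proof. by move=> intf; exact: (parameterized_integral_continuous ler01 intf). Qed.

Lemma eq_primitive f g x : I01 x -> (forall y, I01 y -> f y = g y) ->
  primitive f x = primitive g x.
Proof.
move=> Ix fg; apply: eq_Rintegral => y /set_mem yx; apply: fg.
exact: subset_0x yx.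
Qed.

Lemma primitiveB f g x : integrable01 f -> integrable01 g -> I01 x ->
  primitive (fun y => f y - g y) x = primitive f x - primitive g x.
Proof.
move=> intf intg Ix; have sub := subset_0x Ix.
by apply: RintegralB => //; [exact: integrableS intf|exact: integrableS intg].
Qed.

End IntegralsOnI01.
#[export] Hint Resolve measurable_I01 : core.

(** * Calculus relative to [0,1] *)

(** Relational form of [derive01]: differentiation rules compose without separate derivability
    proofs, and the value is recovered by [has_derive01_unique]. *)
Definition has_derive01 {R : realType} (f : R -> R) (x l : R) : Prop :=
  (f y - f x) / (y - x) @[y --> within I01 x^'] --> l.

Section Derive01.
Context {R : realType}.
Implicit Types (f g : R -> R) (x y l : R).
Notation mu := (@lebesgue_measure R).

(** Uniqueness of relative derivatives rests on this, endpoints included. The witness moves from [x]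
    towards the farther endpoint, by at most 1/2. *)
Lemma within_I01_dnbhs_proper x : I01 x -> ProperFilter (within I01 x^').
Proof.
move=> /I01E /andP[x0 x1]; apply: Build_ProperFilter => H.
have [e /= e0 eP] : exists2 e : R, 0 < e &
    ball x e `<=` (fun y => y != x -> I01 y -> False) by apply/nbhs_ballP.
pose d := Num.min (e / 2) (2^-1).
have d0 : 0 < d by rewrite /d lt_min; apply/andP; split; lra.
have de : d <= e / 2 by rewrite /d ge_min lexx.
have d1 : d <= 2^-1 by rewrite /d ge_min lexx orbT.
have [xh|xh] := ltP x 2^-1.
- apply: (eP (x + d)).
  + by rewrite /ball /= opprD addNKr normrN gtr0_norm//; lra.
  + by rewrite gt_eqF//; lra.
  + by apply/I01E/andP; split; lra.
- apply: (eP (x - d)).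
  + by rewrite /ball /= opprB addrC subrK gtr0_norm//; lra.
  + by rewrite lt_eqF//; lra.
  + by apply/I01E/andP; split; lra.
Qed.

Lemma near_within_I01 x :
  \forall y \near within I01 x^', I01 y /\ y != x.
Proof. by apply: (@filterS _ (nbhs x)) (@filterT _ (nbhs x) _) => y _. Qed.

Lemma cvg_within_I01_id x : y @[y --> within I01 x^'] --> x.
Proof.
apply: cvg_within_filter; exact: (@cvg_within _ (nbhs x)).
Qed.

Lemma has_derive01_unique f x l : I01 x -> has_derive01 f x l ->
  derive01 f x = l.
Proof.
move=> Ix fl; have ? := within_I01_dnbhs_proper Ix.
by apply: cvg_lim => //; exact: Rhausdorff.
Qed.

Lemma has_derive01P f x : derivable01 f x -> has_derive01 f x (derive01 f x).
Proof. by []. Qed.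

Lemma has_derive01_derivable f x l : has_derive01 f x l -> derivable01 f x.
Proof. by move=> fl; apply/cvg_ex; exists l. Qed.

Lemma eq_has_derive01 f g x l : I01 x -> (forall y, I01 y -> f y = g y) ->
  has_derive01 f x l -> has_derive01 g x l.
Proof.
move=> Ix fg; rewrite /has_derive01; apply: cvg_trans; apply: near_eq_cvg.
by apply: filterS (near_within_I01 x) => y [Iy _]; rewrite !fg.
Qed.

Lemma has_derive01_cvg f x l : has_derive01 f x l ->
  f y @[y --> within I01 x^'] --> f x.
Proof.
move=> fl; have : f x + (f y - f x) / (y - x) * (y - x)
    @[y --> within I01 x^'] --> f x + l * (x - x).
  apply: cvgD; first exact: cvg_cst.
  apply: cvgM => //; apply: cvgB; last exact: cvg_cst.
  exact: cvg_within_I01_id.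
rewrite subrr mulr0 addr0; apply: cvg_trans; apply: near_eq_cvg.
apply: filterS (near_within_I01 x) => y [_ yx].
by rewrite divfK ?subr_eq0// addrC subrK.
Qed.

Lemma derivable01_continuous f :
  (forall x, I01 x -> derivable01 f x) -> continuous01 f.
Proof.
move=> df; apply/continuous01P => x Ix.
apply/cvgrPdist_lt => e e0.
have /cvgrPdist_lt /(_ e e0) := has_derive01_cvg (has_derive01P (df x Ix)).
move=> K; have {}K : nbhs x (fun y => y != x -> I01 y -> `|f x - f y| < e) := K.
suff : nbhs x (fun y => I01 y -> `|f x - f y| < e) by [].
apply: filterS K => y /= H Iy.
by have [->|/H] := eqVneq y x; [rewrite subrr normr0|exact].
Qed.

Lemma has_derive01_cst (k : R) x : has_derive01 (cst k) x 0.
Proof.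
by rewrite /has_derive01; under eq_fun do rewrite subrr mul0r; exact: cvg_cst.
Qed.

Lemma has_derive01D f g x l l' : has_derive01 f x l -> has_derive01 g x l' ->
  has_derive01 (fun y => f y + g y) x (l + l').
Proof.
move=> fl gl.
have : (f y - f x) / (y - x) + (g y - g x) / (y - x)
    @[y --> within I01 x^'] --> l + l' by exact: cvgD.
by apply: cvg_trans; apply: near_eq_cvg; near=> y => /=; lra.
Unshelve. all: by end_near. Qed.

Lemma has_derive01M f g x l l' : has_derive01 f x l -> has_derive01 g x l' ->
  has_derive01 (fun y => f y * g y) x (l * g x + f x * l').
Proof.
move=> fl gl.
have : (f y - f x) / (y - x) * g y + f x * ((g y - g x) / (y - x))
    @[y --> within I01 x^'] --> l * g x + f x * l'.
  apply: cvgD; first exact: (cvgM fl (has_derive01_cvg gl)).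
  by apply: cvgM => //; exact: cvg_cst.
by apply: cvg_trans; apply: near_eq_cvg; near=> y => /=; lra.
Unshelve. all: by end_near. Qed.

Lemma has_derive01Z (k : R) f x l : has_derive01 f x l ->
  has_derive01 (fun y => k * f y) x (k * l).
Proof.
by move=> fl; have := has_derive01M (has_derive01_cst k x) fl; rewrite mul0r add0r.
Qed.

Lemma has_derive01B f g x l l' : has_derive01 f x l -> has_derive01 g x l' ->
  has_derive01 (fun y => f y - g y) x (l - l').
Proof.
move=> fl /(has_derive01Z (k := -1)) gl; have := has_derive01D fl gl.
by rewrite mulN1r; under eq_fun do rewrite mulN1r.
Qed.

Lemma has_derive01_sum n (F : nat -> R -> R) (L : nat -> R) x :
  (forall i, has_derive01 (F i) x (L i)) ->
  has_derive01 (fun y => \sum_(i < n) F i y) x (\sum_(i < n) L i).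
Proof.
move=> FL; elim: n => [|n ih].
  by under eq_fun do rewrite big_ord0; rewrite big_ord0; exact: has_derive01_cst.
by under eq_fun do rewrite big_ord_recr /=; rewrite big_ord_recr; exact: has_derive01D.
Qed.

Lemma is_derive_has_derive01 f x l : is_derive x 1 f l -> has_derive01 f x l.
Proof.
move=> /is_derive1_caratheodory[k [fk ck <-]].
have : k y @[y --> within I01 x^'] --> k x.
  by apply: cvg_within_filter; apply: cvg_within_filter; exact: ck.
apply: cvg_trans; apply: near_eq_cvg.
apply: filterS (near_within_I01 x) => y [_ yx].
by rewrite fk mulfK ?subr_eq0.
Qed.

Lemma has_derive01_comp (h : R -> R) f x (a l : R) : is_derive (f x) 1 h a ->
  has_derive01 f x l -> has_derive01 (h \o f) x (a * l).
Proof.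
move=> /is_derive1_caratheodory[k [fk ck <-]] fl.
have : k (f y) * ((f y - f x) / (y - x)) @[y --> within I01 x^'] --> k (f x) * l.
  by apply: cvgM => //; apply: (cvg_comp _ _ (has_derive01_cvg fl)); exact: ck.
by apply: cvg_trans; apply: near_eq_cvg; near=> y; rewrite /= fk mulrA.
Unshelve. all: by end_near. Qed.

Lemma has_derive01_is_derive f x l : 0 < x < 1 -> has_derive01 f x l ->
  is_derive x 1 f l.
Proof.
move=> x01 fl; apply/is_derive1_caratheodory.
exists (fun y => if y == x then l else (f y - f x) / (y - x)); split.
- move=> z; case: eqVneq => [->|zx]; first by rewrite !subrr mulr0.
  by rewrite divfK ?subr_eq0.
- apply/cvgrPdist_lt => e e0; rewrite eqxx.
  move/cvgrPdist_lt : fl => /(_ e e0).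
  have Inx : \forall y \near x, I01 y.
    apply: filterS (@near_in_itvoo R 0 1 x _) => [y /=|]; last by rewrite in_itv.
    by rewrite in_itv/= => /andP[? ?]; apply/I01E; rewrite !ltW.
  rewrite /within /= => H; near=> y.
  case: eqVneq => [_|yx]; first by rewrite subrr normr0.
  have : y != x -> I01 y -> `|l - (f y - f x) / (y - x)| < e by near: y.
  by apply => //; near: y.
- by rewrite eqxx.
Unshelve. all: by end_near. Qed.

(** At interior points the relative derivative is the ordinary one, and at the ends only continuity
    is required, so the classical theorem applies on [0, x]; the degenerate interval x = 0 is
    treated apart. *)
Lemma ftc01 f : (forall x, I01 x -> derivable01 f x) ->
  continuous01 (derive01 f) ->
  forall x, I01 x -> primitive (derive01 f) x = f x - f 0.
Proof.
move=> df cdf x Ix; have /I01E/andP[x0 x1] := Ix.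
move: x0; rewrite le_eqVlt => /predU1P[<-|x0].
  by rewrite primitive0 subrr.
have cf : {within `[0, x], continuous f}.
  apply: continuous_subspaceW (subset_0x Ix) _; exact: derivable01_continuous.
have /(continuous_within_itvP _ x0)[_ cl cr] := cf.
have H : (\int[mu]_(y in `[0%R, x]) (derive01 f y)%:E = (f x)%:E - (f 0)%:E)%E.
  apply: continuous_FTC2 => //.
  - exact: (continuous_subspaceW (subset_0x Ix) cdf).
  - split => // y; rewrite in_itv/= => /andP[y0 yx].
    have y01 : 0 < y < 1 by rewrite y0 (lt_le_trans yx).
    have Iy : I01 y by apply/I01E; move/andP : y01 => [? ?]; rewrite !ltW.
    by have [] := has_derive01_is_derive y01 (has_derive01P (df y Iy)).
  - move=> y; rewrite in_itv/= => /andP[y0 yx].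
    have y01 : 0 < y < 1 by rewrite y0 (lt_le_trans yx).
    have Iy : I01 y by apply/I01E; move/andP : y01 => [? ?]; rewrite !ltW.
    have [_] := has_derive01_is_derive y01 (has_derive01P (df y Iy)).
    by rewrite derive1E.
by rewrite /primitive /Rintegral H.
Qed.

Lemma int01_derive f g : (forall x, I01 x -> has_derive01 f x (g x)) ->
  continuous01 g -> int01 g = f 1 - f 0.
Proof.
move=> fg cg; have fgE x (Ix : I01 x) : g x = derive01 f x.
  by rewrite (has_derive01_unique Ix (fg x Ix)).
rewrite -(ftc01 _ _ I01_1).
- exact: eq_int01.
- by move=> x Ix; exact: (has_derive01_derivable (fg x Ix)).
- exact: eq_continuous01 cg.
Qed.

(** The retraction of the line onto [0,1], that is min (max x 0) 1, written with absolute values so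
    that its continuity is immediate. *)
Definition clamp01 (x : R) : R := (`|x| + 1 - `|x - 1|) / 2.

Lemma clamp01_id x : I01 x -> clamp01 x = x.
Proof.
move=> /I01E/andP[x0 x1]; rewrite /clamp01 ger0_norm// ler0_norm ?subr_le0//; lra.
Qed.

Lemma clamp01_I01 x : I01 (clamp01 x).
Proof.
by apply/I01E; rewrite /clamp01; case: (ger0P x) => ?; case: (ger0P (x - 1)) => ?; lra.
Qed.

Lemma clamp01_continuous : continuous clamp01.
Proof.
move=> x; apply: cvgM; last exact: cvg_cst.
apply: cvgB; first by apply: cvgD; [exact: cvg_norm|exact: cvg_cst].
by apply: cvg_norm; apply: cvgB; [exact: cvg_id|exact: cvg_cst].
Qed.

Lemma cvg_clamp01 x : clamp01 y @[y --> x] --> within I01 (nbhs (clamp01 x)).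
Proof.
move=> A /= /(clamp01_continuous (x := x)) H.
have {}H : nbhs x (fun y => I01 (clamp01 y) -> A (clamp01 y)) := H.
suff : nbhs x (fun y => A (clamp01 y)) by [].
by apply: filterS H => y; apply; exact: clamp01_I01.
Qed.

Lemma continuous_clamp01 f : continuous01 f -> continuous (f \o clamp01).
Proof.
move=> /continuous01P cf x.
exact: cvg_comp (@cvg_clamp01 x) (cf _ (clamp01_I01 x)).
Qed.

(** Composition with [clamp01] extends [g] continuously to the line. Working on [-1, 2] puts the
    endpoints of [0,1] in the interior, where the classical theorem gives a two-sided derivative. *)
Lemma has_derive01_primitive g x : continuous01 g -> I01 x ->
  has_derive01 (primitive g) x (g x).
Proof.
move=> cg Ix; pose G := g \o clamp01.
have cG : continuous G := continuous_clamp01 cg.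
have iG (a b : R) : mu.-integrable `[a, b] (EFin \o G).
  apply: continuous_compact_integrable; first exact: segment_compact.
  exact: continuous_subspaceT.
pose F y := \int[mu]_(t in [set` `[-1, y]]) G t.
have FE y : I01 y -> primitive g y = F y - F 0.
  move=> Iy; have /I01E/andP[y0 y1] := Iy.
  have -> : primitive g y = primitive G y.
    by apply: eq_primitive => // z Iz; rewrite /G /= clamp01_id.
  rewrite /F (@Rintegral_itvB _ G (BLeft (-1)) (BRight y) 0)//;
    last by rewrite bnd_simp; lra.
  rewrite Rintegral_itv_obnd_cbnd//.
  by apply: integrableS (iG 0 y) => //; apply: subset_itvr; rewrite bnd_simp.
have /I01E/andP[x0 x1] := Ix.
have [dF F'] : derivable F x 1 /\ derive1 F x = G x.
  apply: (@continuous_FTC1_closed _ G (-1) x 2) => //; [lra|lra|exact: cG].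
have : has_derive01 (fun y => F y - F 0) x (g x - 0).
  apply: has_derive01B; last exact: has_derive01_cst.
  apply: is_derive_has_derive01.
  by rewrite -[in X in is_derive _ _ _ X](clamp01_id Ix) -[g _]F' derive1E; exact: derivableP.
by rewrite subr0; apply: eq_has_derive01 => // y Iy; rewrite FE.
Qed.

(** For every y, |f(x)| <= |f(y)| + |f'|_2. Moving |f'|_2 to the left, squaring and integrating over
    y replaces |f(y)| by |f|_2. *)
Lemma sup_le_L2norm_derive f : (forall x, I01 x -> derivable01 f x) ->
  continuous01 (derive01 f) ->
  forall x, I01 x -> `|f x| <= L2norm f + L2norm (derive01 f).
Proof.
move=> df cdf x Ix; rewrite -lerBlDr.
have cf := derivable01_continuous df.
have lf := continuous01_L2 cf.
have [k0|k0] := leP (`|f x| - L2norm (derive01 f)) 0.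
  by rewrite (le_trans k0)// L2norm_ge0.
rewrite -ler_sqr ?nnegrE ?L2norm_ge0 ?(ltW k0)// L2norm_sqr//.
rewrite -[leLHS]int01_cst; apply: le_int01.
- by apply: continuous01_integrable; exact: continuous01_cst.
- exact: L2_integrable_sqr.
- move=> y Iy; rewrite -(real_normK (num_real (f y))).
  rewrite lerXn2r ?nnegrE ?(ltW k0)// lerBlDr.
  have := le_norm_primitiveB (continuous01_L2 cdf) Iy Ix.
  rewrite !ftc01// => h.
  have -> : f x = f y + (f x - f 0 - (f y - f 0)) by lra.
  by rewrite (le_trans (ler_normD _ _))// lerD2l.
Qed.

End Derive01.

(** * Spectral estimates for the Neumann problem *)

(** The difference f g'' - f'' g is the derivative of the Wronskian f g' - f' g, which vanishes at
    both ends. *)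
Lemma green_identity {R : realType} (f f1 f2 g g1 g2 : R -> R) :
  (forall x, I01 x -> has_derive01 f x (f1 x)) ->
  (forall x, I01 x -> has_derive01 f1 x (f2 x)) -> continuous01 f2 ->
  (forall x, I01 x -> has_derive01 g x (g1 x)) ->
  (forall x, I01 x -> has_derive01 g1 x (g2 x)) -> continuous01 g2 ->
  f1 0 = 0 -> f1 1 = 0 -> g1 0 = 0 -> g1 1 = 0 ->
  int01 (fun x => f x * g2 x) = int01 (fun x => f2 x * g x).
Proof.
move=> ff1 ff2 cf2 gg1 gg2 cg2 f10 f11 g10 g11.
have cont (h h1 : R -> R) : (forall x, I01 x -> has_derive01 h x (h1 x)) -> continuous01 h.
  by move=> hh; apply: derivable01_continuous => x Ix; exact: (has_derive01_derivable (hh x Ix)).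
have cf := cont _ _ ff1; have cg := cont _ _ gg1.
have c1 : continuous01 (fun x => f x * g2 x) by exact: continuous01M.
have c2 : continuous01 (fun x => f2 x * g x) by exact: continuous01M.
apply/eqP; rewrite -subr_eq0 -int01B; [|exact: continuous01_integrable..].
rewrite (@int01_derive _ (fun x => f x * g1 x - f1 x * g x)).
- by rewrite f10 f11 g10 g11 !(mulr0, mul0r) !subrr.
- move=> x Ix; have -> : f x * g2 x - f2 x * g x =
    (f1 x * g1 x + f x * g2 x) - (f2 x * g x + f1 x * g1 x) by lra.
  by apply: has_derive01B; apply: has_derive01M; auto.
- exact: continuous01B.
Qed.

Lemma dirichlet_identity {R : realType} (f f1 f2 : R -> R) :
  (forall x, I01 x -> has_derive01 f x (f1 x)) ->
  (forall x, I01 x -> has_derive01 f1 x (f2 x)) -> continuous01 f2 ->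
  f1 0 = 0 -> f1 1 = 0 ->
  int01 (fun x => f1 x ^+ 2) = - int01 (fun x => f x * f2 x).
Proof.
move=> ff1 ff2 cf2 f10 f11.
have cont (h h1 : R -> R) : (forall x, I01 x -> has_derive01 h x (h1 x)) -> continuous01 h.
  by move=> hh; apply: derivable01_continuous => x Ix; exact: (has_derive01_derivable (hh x Ix)).
have cf := cont _ _ ff1; have cf1 := cont _ _ ff2.
have c1 : continuous01 (fun x => f x * f2 x) by exact: continuous01M.
have c2 : continuous01 (fun x => f1 x ^+ 2) by exact: continuous01M.
apply/eqP; rewrite -addr_eq0 -int01D; [|exact: continuous01_integrable..].
rewrite (@int01_derive _ (fun x => f x * f1 x)).
- by rewrite f10 f11 !mulr0 subrr.
- by move=> x Ix; rewrite expr2; apply: has_derive01M; auto.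
- exact: continuous01D.
Qed.

Section Spectral.
Context {R : realType}.
Variables (V : R -> R) (mu : nat -> R) (e : nat -> R -> R).
Hypothesis smoothV : smooth01 V.
Hypothesis V_gt0 : forall x, I01 x -> 0 < V x.
Hypothesis E : neumann_eigensystem V mu e.
Implicit Types (x : R) (n i : nat) (a b : nat -> R) (v : R -> R).

Lemma potential_continuous : continuous01 V.
Proof. by apply: derivable01_continuous => x; exact: (@smoothV 0%N x). Qed.

Lemma eigenfun_has_derive n x : I01 x -> has_derive01 (e n) x (derive01 (e n) x).
Proof. by move=> Ix; exact: (has_derive01P (eigenfun_d1 E Ix)). Qed.
Arguments eigenfun_has_derive n [x] _.

Lemma eigenfun_continuous n : continuous01 (e n).
Proof. by apply: derivable01_continuous => x; exact: (eigenfun_d1 E). Qed.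
Arguments eigenfun_continuous : clear implicits.

Lemma eigenfun_derive_continuous n : continuous01 (derive01 (e n)).
Proof. by apply: derivable01_continuous => x; exact: (eigenfun_d2 E). Qed.
Arguments eigenfun_derive_continuous : clear implicits.

Lemma eigenfun_has_derive2 n x : I01 x ->
  has_derive01 (derive01 (e n)) x ((V x - mu n) * e n x).
Proof.
move=> Ix; have -> : (V x - mu n) * e n x = derive01 (derive01 (e n)) x.
  by have := eigenfun_eq E n Ix; lra.
exact: (has_derive01P (eigenfun_d2 E Ix)).
Qed.
Arguments eigenfun_has_derive2 n [x] _.

Lemma eigenfun_derive2_continuous n :
  continuous01 (fun x => (V x - mu n) * e n x).
Proof.
apply: continuous01M; last exact: eigenfun_continuous.
by apply: continuous01B; [exact: potential_continuous|exact: continuous01_cst].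
Qed.
Arguments eigenfun_derive2_continuous : clear implicits.

Lemma eigenfun_L2 n : L2 (e n).
Proof. exact: (continuous01_L2 (eigenfun_continuous n)). Qed.

Lemma eigenval_ge0 n : 0 < mu n.
Proof.
elim: n => [|n ih]; first exact: (eigenval_gt0 E).
exact: (lt_le_trans ih (eigenval_ndecr E n)).
Qed.

Lemma eigenval_homo n m : (n <= m)%N -> mu n <= mu m.
Proof. by apply: (homo_leq (r := fun x y => x <= y)) => //; [exact: le_trans|exact: (eigenval_ndecr E)]. Qed.

(** * Finite eigenfunction sums: energy, sup bound and growth of the eigenvalues *)

Lemma coef_eigensum n b i : (i < n)%N ->
  int01 (fun x => e i x * \sum_(j < n) b j * e j x) = b i.
Proof.
move=> ni.
rewrite (@eq_int01 _ _ (fun x => \sum_(j < n) b j * (e i x * e j x))); last first.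
  by move=> x _; rewrite mulr_sumr; apply: eq_bigr => j _; lra.
rewrite (@int01_sum _ _ (fun j x => b j * (e i x * e j x))); last first.
  by move=> j; apply: integrable01Z; exact: (L2_integrableM (eigenfun_L2 _) (eigenfun_L2 _)).
rewrite (bigD1 (Ordinal ni))//= big1 ?addr0.
  rewrite int01Z; last exact: (L2_integrableM (eigenfun_L2 _) (eigenfun_L2 _)).
  by rewrite (eigenfun_orthonormal E) eqxx mulr1.
move=> j ji; rewrite int01Z; last exact: (L2_integrableM (eigenfun_L2 _) (eigenfun_L2 _)).
rewrite (eigenfun_orthonormal E) (_ : (i == j :> nat) = false) ?mulr0//.
by apply/negbTE; apply: contra ji => /eqP ij; apply/eqP/val_inj.
Qed.

Lemma eigensum_continuous n b : continuous01 (fun x => \sum_(j < n) b j * e j x).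
Proof.
apply: (@continuous01_sum _ _ (fun j x => b j * e j x)) => j.
exact: (continuous01Z (eigenfun_continuous j)).
Qed.
Arguments eigensum_continuous : clear implicits.

Lemma int01_mul_eigensum n a v : L2 v ->
  int01 (fun x => v x * \sum_(i < n) a i * e i x) =
    \sum_(i < n) a i * coef e i v.
Proof.
move=> lv.
rewrite (@eq_int01 _ _ (fun x => \sum_(i < n) a i * (e i x * v x))); last first.
  by move=> x _; rewrite mulr_sumr; apply: eq_bigr => i _; lra.
rewrite (@int01_sum _ _ (fun i x => a i * (e i x * v x))); last first.
  by move=> i; apply: integrable01Z; exact: (L2_integrableM (eigenfun_L2 _) lv).
by apply: eq_bigr => i _; rewrite int01Z//; exact: (L2_integrableM (eigenfun_L2 _) lv).
Qed.

Lemma int01_eigensumM n a b :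
  int01 (fun x => (\sum_(i < n) a i * e i x) * \sum_(j < n) b j * e j x) =
  \sum_(i < n) a i * b i.
Proof.
rewrite int01_mul_eigensum; last exact: (continuous01_L2 (eigensum_continuous _ _)).
by apply: eq_bigr => i _; rewrite /coef coef_eigensum// mulrC.
Qed.

(** By the Dirichlet identity and orthonormality, the left side is the right side minus the integral
    of V f^2, where f is the eigenfunction sum and V is positive. *)
Lemma eigensum_energy n a :
  int01 (fun x => (\sum_(i < n) a i * derive01 (e i) x) ^+ 2) <=
  \sum_(i < n) mu i * a i ^+ 2.
Proof.
pose f x := \sum_(i < n) a i * e i x.
pose f2 x := \sum_(i < n) a i * ((V x - mu i) * e i x).
rewrite (@dirichlet_identity _ f _ f2); first last.
- by rewrite big1// => i _; rewrite (eigenfun_bc E i).2 mulr0.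
- by rewrite big1// => i _; rewrite (eigenfun_bc E i).1 mulr0.
- apply: (@continuous01_sum _ _ (fun i x => a i * ((V x - mu i) * e i x))) => i.
  exact: (continuous01Z (eigenfun_derive2_continuous i)).
- move=> x Ix; apply: (@has_derive01_sum _ _ (fun i x => a i * derive01 (e i) x)
    (fun i => a i * ((V x - mu i) * e i x))) => i.
  exact: (has_derive01Z (eigenfun_has_derive2 i Ix)).
- move=> x Ix; apply: (@has_derive01_sum _ _ (fun i x => a i * e i x)
    (fun i => a i * derive01 (e i) x)) => i.
  exact: (has_derive01Z (eigenfun_has_derive i Ix)).
have cf : continuous01 f by exact: eigensum_continuous.
have -> : \sum_(i < n) mu i * a i ^+ 2 = \sum_(i < n) a i * (mu i * a i).
  by apply: eq_bigr => i _; lra.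
rewrite -(int01_eigensumM n a (fun i => mu i * a i)).
have cg : continuous01 (fun x => \sum_(j < n) (mu j * a j) * e j x).
  exact: (eigensum_continuous n (fun j => mu j * a j)).
have iVf : integrable01 (fun x => V x * f x ^+ 2).
  apply: continuous01_integrable; apply: continuous01M; first exact: potential_continuous.
  exact: continuous01M.
have ifg := continuous01_integrable (continuous01M cf cg).
rewrite (@eq_int01 _ _ (fun x => V x * f x ^+ 2 -
    f x * (\sum_(j < n) (mu j * a j) * e j x))); last first.
  move=> x _; have -> : f2 x = V x * f x - \sum_(j < n) (mu j * a j) * e j x.
    by rewrite mulr_sumr -sumrB; apply: eq_bigr => i _; lra.
  lra.
rewrite int01B// opprB gerBl; apply: int01_ge0 => x Ix.
by rewrite mulr_ge0 ?sqr_ge0// ltW// V_gt0.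
Qed.

(** The Sobolev bound squared, with (N + N')^2 <= 2 (N^2 + N'^2); orthonormality and the energy
    estimate control the two squares. *)
Lemma eigensum_sup n a x : I01 x ->
  (\sum_(i < n) a i * e i x) ^+ 2 <= 2 * \sum_(i < n) (1 + mu i) * a i ^+ 2.
Proof.
move=> Ix; pose f x := \sum_(i < n) a i * e i x.
pose f1 x := \sum_(i < n) a i * derive01 (e i) x.
have ff1 y (Iy : I01 y) : has_derive01 f y (f1 y).
  apply: (@has_derive01_sum _ _ (fun i x => a i * e i x)
    (fun i => a i * derive01 (e i) y)) => i.
  exact: (has_derive01Z (eigenfun_has_derive i Iy)).
have cf1 : continuous01 f1.
  apply: (@continuous01_sum _ _ (fun i x => a i * derive01 (e i) x)) => i.
  exact: (continuous01Z (eigenfun_derive_continuous i)).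
have f1E y (Iy : I01 y) : f1 y = derive01 f y.
  by rewrite (has_derive01_unique Iy (ff1 y Iy)).
have := sup_le_L2norm_derive (fun y Iy => has_derive01_derivable (ff1 y Iy))
  (eq_continuous01 f1E cf1) Ix.
rewrite -(eq_L2norm f1E) -/(f x).
have := L2norm_sqr (continuous01_L2 cf1).
have := L2norm_sqr (continuous01_L2 (eigensum_continuous n a)).
have := int01_eigensumM n a a; under eq_int01 do rewrite -expr2.
move=> ->; have := eigensum_energy n a; rewrite -/f1 -/f.
have -> : \sum_(i < n) (1 + mu i) * a i ^+ 2 =
    \sum_(i < n) mu i * a i ^+ 2 + \sum_(i < n) a i * a i.
  by rewrite -big_split /=; apply: eq_bigr => i _; lra.
have := L2norm_ge0 f; have := L2norm_ge0 f1.
move: (L2norm f) (L2norm f1) (\sum_(i < n) mu i * a i ^+ 2) (\sum_(i < n) a i * a i) (int01 _).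
move=> N N1 S1 S2 I1 N10 N0 I1S E2 E1 h.
have : f x ^+ 2 <= (N + N1) ^+ 2.
  by rewrite -(real_normK (num_real (f x))) lerXn2r ?nnegrE// addr_ge0.
have := sqr_ge0 (N - N1); nra.
Qed.

(* Testing the sup bound on the kernel [sum_i e_i(x) e_i / (1 + mu_i)] bounds the diagonal of the Green function. *)
Lemma resolvent_diagonal n x : I01 x ->
  \sum_(i < n) e i x ^+ 2 / (1 + mu i) <= 2.
Proof.
move=> Ix; have := eigensum_sup n (fun i => e i x / (1 + mu i)) Ix.
have p i : 1 + mu i != 0 by rewrite gt_eqF// ltr_wpDl// eigenval_ge0.
have -> : \sum_(i < n) e i x / (1 + mu i) * e i x =
    \sum_(i < n) e i x ^+ 2 / (1 + mu i) by apply: eq_bigr => i _; lra.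
have -> : \sum_(i < n) (1 + mu i) * (e i x / (1 + mu i)) ^+ 2 =
    \sum_(i < n) e i x ^+ 2 / (1 + mu i).
  apply: eq_bigr => i _.
  have -> : (1 + mu i) * (e i x / (1 + mu i)) ^+ 2 =
    ((1 + mu i) / (1 + mu i)) * (e i x ^+ 2 / (1 + mu i)) by lra.
  by rewrite divff// mul1r.
have : 0 <= \sum_(i < n) e i x ^+ 2 / (1 + mu i).
  apply: sumr_ge0 => i _; rewrite mulr_ge0 ?sqr_ge0// invr_ge0 addr_ge0// ltW//.
  exact: eigenval_ge0.
move: (\sum_(i < n) _) => S; nra.
Qed.

(** Integrates the diagonal bound over x. This growth of the eigenvalues stands in for Weyl
    asymptotics. *)
Lemma resolvent_trace n : \sum_(i < n) (1 + mu i)^-1 <= 2.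
Proof.
have ic i : integrable01 (fun x => e i x ^+ 2 / (1 + mu i)).
  have := integrable01Z (1 + mu i)^-1 (L2_integrable_sqr (eigenfun_L2 i)).
  by under eq_fun do rewrite mulrC.
have -> : \sum_(i < n) (1 + mu i)^-1 =
    int01 (fun x => \sum_(i < n) e i x ^+ 2 / (1 + mu i)).
  rewrite (@int01_sum _ _ (fun i x => e i x ^+ 2 / (1 + mu i)))//.
  apply: eq_bigr => i _.
  rewrite (@eq_int01 _ _ (fun x => (1 + mu i)^-1 * (e i x * e i x))); last by move=> x _; lra.
  rewrite int01Z; last exact: (L2_integrableM (eigenfun_L2 _) (eigenfun_L2 _)).
  by rewrite (eigenfun_orthonormal E) eqxx mulr1.
rewrite -[leRHS]int01_cst; apply: le_int01.
- exact: (@integrable01_sum _ _ (fun i x => e i x ^+ 2 / (1 + mu i))).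
- by apply: continuous01_integrable; exact: continuous01_cst.
- by move=> x Ix; exact: resolvent_diagonal.
Qed.

(** One factor 1 / (1 + mu_i) is kept for the trace bound, so the exponential has to absorb (1 +
    mu_i)^3. *)
Lemma eigenval_heat_moment (t : R) : 0 < t -> exists2 K : R, 0 <= K &
  forall n, \sum_(i < n) (1 + mu i) ^+ 2 * expR (- (t * mu i)) <= K.
Proof.
move=> t0; have k0 : 0 <= 3 / t by rewrite divr_ge0 ?ltW.
(* The cube of y exp(- t y / 3) <= 3 / t with y = 1 + mu_i; [expR t] compensates the shift by 1, and
   2 bounds the trace. *)
exists ((3 / t) ^+ 3 * expR t * 2).
  by rewrite !mulr_ge0 ?expR_ge0 ?invr_ge0 ?ltW.
move=> n; apply: (@le_trans _ _ ((3 / t) ^+ 3 * expR t * \sum_(i < n) (1 + mu i)^-1)).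
  rewrite mulr_sumr; apply: ler_sum => i _.
  have y0 : 0 < 1 + mu i by rewrite ltr_wpDl// eigenval_ge0.
  rewrite ler_pdivlMr//.
  have -> : expR (- (t * mu i)) = expR t * (expR (- (t * (1 + mu i) / 3))) ^+ 3.
    by rewrite -expRM_natl -expRD; congr expR; rewrite mulr_natl; lra.
  set z := expR (- (t * (1 + mu i) / 3)); have z0 : 0 <= z := expR_ge0 _.
  have H : (1 + mu i) * z <= 3 / t.
    rewrite /z expRN ler_pdivrMr ?expR_gt0//.
    have := expR_ge1Dx (t * (1 + mu i) / 3).
    rewrite -(ler_pM2l (divr_gt0 (ltr0n R 3) t0)).
    have -> : 3 / t * (1 + t * (1 + mu i) / 3) = 3 / t + (t / t) * (1 + mu i) by lra.
    rewrite divff ?gt_eqF//; have := divr_gt0 (ltr0n R 3) t0; lra.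
  have : ((1 + mu i) * z) ^+ 3 <= (3 / t) ^+ 3.
    by rewrite lerXn2r// nnegrE ?mulr_ge0 ?divr_ge0// ltW.
  rewrite -(ler_pM2l (expR_gt0 t)); lra.
rewrite ler_wpM2l ?resolvent_trace//.
by rewrite !mulr_ge0 ?expR_ge0 ?invr_ge0 ?ltW.
Qed.

Lemma eigenfun_L2norm n : L2norm (e n) = 1.
Proof.
apply/eqP; rewrite -(eqrXn2 (n := 2)) ?L2norm_ge0// expr1n L2norm_sqr; last exact: eigenfun_L2.
by under eq_int01 do rewrite expr2; rewrite (eigenfun_orthonormal E) eqxx.
Qed.

(** The Dirichlet identity gives |e_n'|_2^2 = mu_n - int V e_n^2 <= mu_n; the summand 1 is the norm
    of e_n. *)
Lemma eigenfun_sup n x : I01 x -> `|e n x| <= 1 + Num.sqrt (mu n).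
Proof.
move=> Ix; have := sup_le_L2norm_derive (fun y => @eigenfun_d1 _ _ _ _ E n y)
  (eigenfun_derive_continuous n) Ix.
rewrite eigenfun_L2norm => /le_trans; apply; rewrite lerD2l.
have m0 := ltW (eigenval_ge0 n).
apply: L2norm_le; [exact: (continuous01_L2 (eigenfun_derive_continuous n))|exact: sqrtr_ge0|].
rewrite sqr_sqrtr//.
rewrite (@dirichlet_identity _ (e n) _ (fun x => (V x - mu n) * e n x)); first last.
- exact: (eigenfun_bc E n).2.
- exact: (eigenfun_bc E n).1.
- exact: eigenfun_derive2_continuous.
- by move=> y; exact: eigenfun_has_derive2.
- by move=> y; exact: eigenfun_has_derive.
have i1 := L2_integrableM (eigenfun_L2 n) (eigenfun_L2 n).
rewrite (@eq_int01 _ _ (fun x => V x * (e n x * e n x) - mu n * (e n x * e n x))); last first.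
  by move=> y _; lra.
rewrite int01B; last 2 first.
- apply: continuous01_integrable; apply: continuous01M; first exact: potential_continuous.
  by apply: continuous01M; exact: eigenfun_continuous.
- exact: integrable01Z.
rewrite int01Z// (eigenfun_orthonormal E) eqxx mulr1 opprB gerBl.
by apply: int01_ge0 => y Iy; rewrite mulr_ge0 -?expr2 ?sqr_ge0// ltW// V_gt0.
Qed.

(** Since e_n' vanishes at 0, it is the primitive of (V - mu_n) e_n, whose norm is at most 1 + M +
    mu_n <= (1 + M) (1 + mu_n) when |V| <= M. *)
Lemma eigenfun_derive_sup : exists2 K : R, 0 < K &
  forall n x, I01 x -> `|derive01 (e n) x| <= K * (1 + mu n).
Proof.
have [M M0 VM] := continuous01_bounded potential_continuous.
exists (1 + M); first by rewrite ltr_wpDl.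
move=> n x Ix; have m0 := eigenval_ge0 n.
have c2 := eigenfun_derive2_continuous n.
have d2E y (Iy : I01 y) : (V y - mu n) * e n y = derive01 (derive01 (e n)) y.
  by rewrite (has_derive01_unique Iy (eigenfun_has_derive2 n Iy)).
have := ftc01 (fun y => @eigenfun_d2 _ _ _ _ E n y) (eq_continuous01 d2E c2) Ix.
rewrite (eigenfun_bc E n).1 subr0 => <-.
rewrite -(eq_primitive Ix d2E).
apply: (le_trans (le_norm_primitive (continuous01_L2 c2) Ix)).
have lZ := L2Z (1 + M + mu n) (eigenfun_L2 n).
apply: (@le_trans _ _ (L2norm (fun y => (1 + M + mu n) * e n y))).
  apply: L2norm_le_pointwise => //; first exact: continuous01_L2.
  move=> y Iy; rewrite !normrM ler_wpM2r// [leRHS]ger0_norm; last by lra.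
  by have := VM y Iy; rewrite !ler_norml => /andP[? ?]; apply/andP; split; lra.
rewrite L2normZ; last exact: eigenfun_L2.
rewrite eigenfun_L2norm mulr1 ger0_norm; last by lra.
have := mulr_ge0 (ltW M0) (ltW m0); lra.
Qed.

(** * Bessel's inequality and the projection onto the ground state *)

Lemma bessel01 n v : L2 v -> \sum_(i < n) coef e i v ^+ 2 <= L2norm v ^+ 2.
Proof.
move=> lv; pose c i := coef e i v; pose s x := \sum_(i < n) c i * e i x.
have cs : continuous01 s := eigensum_continuous n c.
have ls := continuous01_L2 cs.
rewrite L2norm_sqr//.
have : 0 <= int01 (fun x => (v x - s x) ^+ 2) by apply: int01_ge0 => x _; exact: sqr_ge0.
have i1 := L2_integrable_sqr lv; have i2 := L2_integrable_sqr ls.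
have i3 := L2_integrableM lv ls.
rewrite (@eq_int01 _ _ (fun x => v x ^+ 2 + (-2) * (v x * s x) + s x ^+ 2)); last by move=> x _; lra.
rewrite int01D//; last by apply: integrable01D => //; exact: integrable01Z.
rewrite int01D//; last exact: integrable01Z.
rewrite int01Z// int01_mul_eigensum//.
have -> : int01 (fun x => s x ^+ 2) = \sum_(i < n) c i * c i.
  by rewrite -int01_eigensumM; apply: eq_int01 => x _; rewrite expr2.
have -> : \sum_(i < n) coef e i v ^+ 2 = \sum_(i < n) c i * c i.
  by apply: eq_bigr => i _; rewrite expr2.
rewrite -/(coef _ _ _) /c; lra.
Qed.

Lemma coef_sub_ground n v : L2 v ->
  coef e n (fun x => v x - coef e 0 v * e 0%N x) =
    if n == 0%N then 0 else coef e n v.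
Proof.
move=> lv; rewrite {1}/coef.
have i1 := L2_integrableM (eigenfun_L2 n) lv.
have i2 := L2_integrableM (eigenfun_L2 n) (eigenfun_L2 0%N).
rewrite (@eq_int01 _ _ (fun x => e n x * v x - coef e 0 v * (e n x * e 0%N x))); last by move=> x _; lra.
rewrite int01B//; last exact: integrable01Z.
rewrite int01Z// (eigenfun_orthonormal E) -/(coef e n v).
by case: eqP => [->|_]; rewrite ?mulr1 ?mulr0 ?subrr ?subr0.
Qed.

Lemma L2_sub_ground v : L2 v -> L2 (fun x => v x - coef e 0 v * e 0%N x).
Proof. by move=> lv; apply: L2B => //; exact: (L2Z _ (eigenfun_L2 0%N)). Qed.

(** Bessel's inequality for v - c_0 e_0, whose coefficients are those of v except that the one at 0
    vanishes. This is how the defect, and not the full norm, enters the convergence condition. *)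
Lemma sum_coef_sqr n v : L2 v -> \sum_(1 <= q < n) coef e q v ^+ 2 <=
  L2norm (fun x => v x - coef e 0 v * e 0%N x) ^+ 2.
Proof.
move=> lv; apply: le_trans (bessel01 n (L2_sub_ground lv)).
case: n => [|n]; first by rewrite big_geq// big_ord0.
rewrite big_ord_recl coef_sub_ground//= expr0n/= add0r big_add1 big_mkord /=.
by rewrite le_eqVlt; apply/orP; left; apply/eqP; apply: eq_bigr => i _; rewrite coef_sub_ground.
Qed.

(** Pythagoras: c_0 e_0 is the orthogonal projection of v onto the line of e_0. The case k e_0 =
    [f0] compares the defect with the distance to [f0]. *)
Lemma sub_ground_le (k : R) v : L2 v ->
  L2norm (fun x => v x - coef e 0 v * e 0%N x) <=
  L2norm (fun x => v x - k * e 0%N x).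
Proof.
move=> lv; have lw := L2_sub_ground lv; have l0 := eigenfun_L2 0%N.
apply: L2norm_le => //; first exact: L2norm_ge0.
set c := coef e 0 v.
rewrite L2norm_sqr; last by apply: L2B => //; exact: L2Z.
have i1 := L2_integrable_sqr lw; have i2 := L2_integrableM l0 lw.
have i3 := L2_integrableM l0 l0.
rewrite [leRHS](@eq_int01 _ _ (fun x => (v x - c * e 0%N x) ^+ 2 +
  (2 * (c - k)) * (e 0%N x * (v x - c * e 0%N x)) + (c - k) ^+ 2 * (e 0%N x * e 0%N x))); last by move=> x _; lra.
rewrite int01D//; last 2 first.
- by apply: integrable01D => //; exact: integrable01Z.
- exact: integrable01Z.
rewrite int01D//; last exact: integrable01Z.
rewrite !int01Z// (eigenfun_orthonormal E) eqxx mulr1.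
have := coef_sub_ground 0%N lv; rewrite /= {1}/coef => ->.
by rewrite mulr0 addr0 lerDl sqr_ge0.
Qed.

(** * Uniform expansion of a function and of its derivative *)

Section Expansion.
Variables f f1 f2 : R -> R.
Hypothesis ff1 : forall x, I01 x -> has_derive01 f x (f1 x).
Hypothesis ff2 : forall x, I01 x -> has_derive01 f1 x (f2 x).
Hypothesis cf2 : continuous01 f2.
Hypotheses (f10 : f1 0 = 0) (f11 : f1 1 = 0).

Let cf : continuous01 f.
Proof. by apply: derivable01_continuous => x /ff1; exact: has_derive01_derivable. Qed.

Let cf1 : continuous01 f1.
Proof. by apply: derivable01_continuous => x /ff2; exact: has_derive01_derivable. Qed.

(** Symmetry of the Neumann operator, through Green's identity. *)
Lemma coef_schroedinger n :
  coef e n (fun x => f2 x - V x * f x) = - (mu n * coef e n f).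
Proof.
have cV := potential_continuous; have ce := eigenfun_continuous n.
have i1 : integrable01 (fun x => e n x * f x) by apply: continuous01_integrable; exact: continuous01M.
have i2 : integrable01 (fun x => e n x * f2 x) by apply: continuous01_integrable; exact: continuous01M.
have i3 : integrable01 (fun x => e n x * (V x * f x)).
  by apply: continuous01_integrable; apply: continuous01M => //; exact: continuous01M.
rewrite /coef (@eq_int01 _ _ (fun x => e n x * f2 x - e n x * (V x * f x))); last by move=> x _; lra.
rewrite int01B//.
rewrite (@green_identity _ (e n) (derive01 (e n)) (fun x => (V x - mu n) * e n x) f f1 f2)//; first last.
- exact: (eigenfun_bc E n).2.
- exact: (eigenfun_bc E n).1.
- exact: eigenfun_derive2_continuous.
- by move=> y; exact: eigenfun_has_derive2.
- by move=> y; exact: eigenfun_has_derive.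
rewrite (@eq_int01 _ _ (fun x => e n x * (V x * f x) - mu n * (e n x * f x))); last by move=> x _; lra.
rewrite int01B//; last exact: integrable01Z.
rewrite int01Z//; lra.
Qed.

Let r n x := f x - \sum_(k < n) coef e k f * e k x.
Let r1 n x := f1 x - \sum_(k < n) coef e k f * derive01 (e k) x.
Let r2 n x := f2 x - \sum_(k < n) coef e k f * ((V x - mu k) * e k x).

(** The remainder satisfies r'' = G + V r, with G the remainder of f'' - V f, because
    [coef_schroedinger] matches the coefficients. Completeness makes r and G small in L2, hence also
    r''. As r' vanishes at 0, it is at most |r''|_2, and the Sobolev bound then controls r. *)
Lemma eigen_expansion_uniform : exists2 d : nat -> R, d n @[n --> \oo] --> (0 : R) &
  forall n x, I01 x -> `|r n x| <= d n /\ `|r1 n x| <= d n.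
Proof.
have cV := potential_continuous.
have [M M0 VM] := continuous01_bounded cV.
pose g x := f2 x - V x * f x.
have cg : continuous01 g by apply: continuous01B => //; exact: continuous01M.
pose G n x := g x - \sum_(k < n) coef e k g * e k x.
have cr n : continuous01 (r n).
  by apply: continuous01B => //; exact: (eigensum_continuous n (fun k => coef e k f)).
have cG n : continuous01 (G n).
  by apply: continuous01B => //; exact: (eigensum_continuous n (fun k => coef e k g)).
have cr2 n : continuous01 (r2 n).
  apply: continuous01B => //.
  apply: (@continuous01_sum _ _ (fun k x => coef e k f * ((V x - mu k) * e k x))) => k.
  exact: (continuous01Z (eigenfun_derive2_continuous k)).
have cr1 n : continuous01 (r1 n).
  apply: continuous01B => //.
  apply: (@continuous01_sum _ _ (fun k x => coef e k f * derive01 (e k) x)) => k.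
  exact: (continuous01Z (eigenfun_derive_continuous k)).
have rr1 n x : I01 x -> has_derive01 (r n) x (r1 n x).
  move=> Ix; apply: has_derive01B; first exact: ff1.
  apply: (@has_derive01_sum _ _ (fun k x => coef e k f * e k x)
    (fun k => coef e k f * derive01 (e k) x)) => k.
  exact: (has_derive01Z (eigenfun_has_derive k Ix)).
have rr2 n x : I01 x -> has_derive01 (r1 n) x (r2 n x).
  move=> Ix; apply: has_derive01B; first exact: ff2.
  apply: (@has_derive01_sum _ _ (fun k x => coef e k f * derive01 (e k) x)
    (fun k => coef e k f * ((V x - mu k) * e k x))) => k.
  exact: (has_derive01Z (eigenfun_has_derive2 k Ix)).
have r2E n x : r2 n x = G n x + V x * r n x.
  rewrite /r2 /G /g /r.
  have -> : \sum_(k < n) coef e k f * ((V x - mu k) * e k x) =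
      V x * (\sum_(k < n) coef e k f * e k x) + \sum_(k < n) coef e k g * e k x.
    rewrite mulr_sumr -big_split /=; apply: eq_bigr => k _.
    rewrite coef_schroedinger; lra.
  lra.
have nr2 n : L2norm (r2 n) <= L2norm (G n) + M * L2norm (r n).
  have lVr : L2 (fun x => V x * r n x) by apply: continuous01_L2; exact: continuous01M.
  have -> : L2norm (r2 n) = L2norm (fun x => G n x + V x * r n x).
    by apply: eq_L2norm => x _; rewrite r2E.
  apply: (le_trans (L2normD (continuous01_L2 (cG n)) lVr)); rewrite lerD2l.
  rewrite -[X in X * _](ger0_norm (ltW M0)) -L2normZ; last exact: continuous01_L2.
  apply: L2norm_le_pointwise => //; first by apply: L2Z; exact: continuous01_L2.
  by move=> y Iy; rewrite !normrM ler_wpM2r// (ger0_norm (ltW M0)) VM.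
have dr n x (Ix : I01 x) : r1 n x = derive01 (r n) x.
  by rewrite (has_derive01_unique Ix (rr1 n x Ix)).
have dr1 n x (Ix : I01 x) : r2 n x = derive01 (r1 n) x.
  by rewrite (has_derive01_unique Ix (rr2 n x Ix)).
have b1 n x : I01 x -> `|r1 n x| <= L2norm (r2 n).
  move=> Ix.
  have := ftc01 (fun y Iy => has_derive01_derivable (rr2 n y Iy)) (eq_continuous01 (dr1 n) (cr2 n)) Ix.
  have -> : r1 n 0 = 0.
    by rewrite /r1 f10 big1 ?subrr// => k _; rewrite (eigenfun_bc E k).1 mulr0.
  rewrite subr0 => <-; rewrite -(eq_primitive Ix (dr1 n)).
  exact: (le_norm_primitive (continuous01_L2 (cr2 n)) Ix).
have b0 n x : I01 x -> `|r n x| <= L2norm (r n) + L2norm (r2 n).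
  move=> Ix; have := sup_le_L2norm_derive
    (fun y Iy => has_derive01_derivable (rr1 n y Iy)) (eq_continuous01 (dr n) (cr1 n)) Ix.
  move=> /le_trans; apply; rewrite lerD2l -(eq_L2norm (dr n)).
  by apply: L2norm_bounded; [exact: continuous01_L2|exact: L2norm_ge0|exact: b1].
exists (fun n => L2norm (r n) + (L2norm (G n) + M * L2norm (r n))).
  have h1 : L2norm (r n) @[n --> \oo] --> (0 : R) := eigenfun_complete E (continuous01_L2 cf).
  have h2 : L2norm (G n) @[n --> \oo] --> (0 : R) := eigenfun_complete E (continuous01_L2 cg).
  have -> : (0 : R) = 0 + (0 + M * 0) by rewrite mulr0 !addr0.
  by apply: cvgD => //; apply: cvgD => //; apply: cvgM => //; exact: cvg_cst.
move=> n x Ix; split.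
  by apply: (le_trans (b0 n x Ix)); rewrite lerD2l.
by apply: (le_trans (b1 n x Ix)); rewrite (le_trans (nr2 n))// lerDr L2norm_ge0.
Qed.

Lemma eigen_expansion_cvg x : I01 x ->
  \sum_(k < n) coef e k f * e k x @[n --> \oo] --> f x /\
  \sum_(k < n) coef e k f * derive01 (e k) x @[n --> \oo] --> f1 x.
Proof.
move=> Ix; have [d d0 rd] := eigen_expansion_uniform.
split; apply/cvgrPdist_lt => eps eps0; move/cvgrPdist_lt : d0 => /(_ eps eps0);
  apply: filterS => n; rewrite sub0r normrN; apply: le_lt_trans;
  rewrite (le_trans _ (ler_norm _))//; by have [] := rd n x Ix.
Qed.

End Expansion.

End Spectral.

Arguments eigenfun_continuous {R V mu e} E n.
Arguments eigenfun_derive_continuous {R V mu e} E n.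
Arguments eigenfun_has_derive {R V mu e} E n [x] _.
Arguments eigenfun_has_derive2 {R V mu e} E n [x] _.
Arguments eigenfun_derive2_continuous {R V mu e} smoothV E n.

(** * The Cole-Hopf transform *)

Lemma expR_half {R : realType} (y : R) : expR y = expR (2^-1 * y) * expR (2^-1 * y).
Proof. by rewrite -expRD; congr expR; lra. Qed.

Section ColeHopf.
Context {R : realType}.
Variables (V : R -> R) (mu : nat -> R) (e : nat -> R -> R).
Hypothesis E : neumann_eigensystem V mu e.
Implicit Types (u v : R -> R) (x : R) (n : nat).

Lemma cole_hopf_numE u x : cole_hopf_num u x = expR (- (2^-1 * primitive u x)).
Proof. by []. Qed.

Lemma cole_hopf_num_gt0 u x : 0 < cole_hopf_num u x.
Proof. exact: expR_gt0. Qed.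

Lemma cole_hopf_num_continuous u : L2 u -> continuous01 (cole_hopf_num u).
Proof.
move=> lu; apply: (continuous01_comp (g := expR)); first exact: continuous_expR.
have := continuous01Z (k := - 2^-1) (primitive_continuous (L2_integrable lu)).
by under eq_fun do rewrite mulNr.
Qed.

Lemma int01_gt0 (f : R -> R) (k : R) : 0 < k -> integrable01 f ->
  (forall x, I01 x -> k <= f x) -> 0 < int01 f.
Proof.
move=> k0 intf kf; apply: (lt_le_trans k0); rewrite -[leLHS]int01_cst.
by apply: le_int01 => //; apply: continuous01_integrable; exact: continuous01_cst.
Qed.

Lemma continuous01_min (f : R -> R) : continuous01 f ->
  (forall x, I01 x -> 0 < f x) -> exists2 k, 0 < k & forall x, I01 x -> k <= f x.
Proof.
move=> cf f0; have [c Ic cP] := EVT_min ler01 cf.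
by exists (f c); [exact: f0|move=> x Ix; exact: cP].
Qed.

Lemma int01_continuous_gt0 (f : R -> R) : continuous01 f ->
  (forall x, I01 x -> 0 < f x) -> 0 < int01 f.
Proof.
move=> cf f0; have [k k0 kf] := continuous01_min cf f0.
exact: (int01_gt0 k0 (continuous01_integrable cf) kf).
Qed.

Lemma int01_cole_hopf_num_gt0 u : L2 u -> 0 < int01 (cole_hopf_num u).
Proof.
move=> lu; apply: int01_continuous_gt0; first exact: cole_hopf_num_continuous.
by move=> x _; exact: cole_hopf_num_gt0.
Qed.

Lemma cole_hopf_continuous u : L2 u -> continuous01 (cole_hopf u).
Proof.
move=> lu.
have := continuous01Z (k := (int01 (cole_hopf_num u))^-1) (cole_hopf_num_continuous lu).
by under eq_fun do rewrite mulrC.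
Qed.

Lemma cole_hopf_gt0 u x : L2 u -> 0 < cole_hopf u x.
Proof. by move=> lu; rewrite divr_gt0 ?cole_hopf_num_gt0 ?int01_cole_hopf_num_gt0. Qed.

Lemma int01_cole_hopf u : L2 u -> int01 (cole_hopf u) = 1.
Proof.
move=> lu; rewrite (@eq_int01 _ _ (fun x => (int01 (cole_hopf_num u))^-1 * cole_hopf_num u x)).
  rewrite int01Z ?mulVf// ?gt_eqF ?int01_cole_hopf_num_gt0//.
  exact: (continuous01_integrable (cole_hopf_num_continuous lu)).
by move=> x _; rewrite mulrC.
Qed.

Lemma coef_cole_hopf n u : L2 u ->
  coef e n (cole_hopf u) = coef e n (cole_hopf_num u) / int01 (cole_hopf_num u).
Proof.
move=> lu; rewrite /coef (@eq_int01 _ _ (fun x =>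
  (int01 (cole_hopf_num u))^-1 * (e n x * cole_hopf_num u x))).
  rewrite int01Z 1?mulrC//; apply: continuous01_integrable; apply: continuous01M.
    exact: (eigenfun_continuous E).
  exact: cole_hopf_num_continuous.
by move=> x _; rewrite /cole_hopf; lra.
Qed.

Lemma coef0_gt0 u : continuous01 u -> (forall x, I01 x -> 0 < u x) ->
  0 < coef e 0 u.
Proof.
move=> cu u0; apply: int01_continuous_gt0.
  by apply: continuous01M => //; exact: (eigenfun_continuous E).
by move=> x Ix; rewrite mulr_gt0 ?u0//; exact: (eigenfun0_gt0 E).
Qed.

(** The normalising integral cancels, so the evolution can be studied on the numerator, whose time
    derivative is explicit. *)
Lemma coef_cole_hopf_ratio n u : L2 u ->
  coef e n (cole_hopf u) / coef e 0 (cole_hopf u) =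
  coef e n (cole_hopf_num u) / coef e 0 (cole_hopf_num u).
Proof.
move=> lu; rewrite !coef_cole_hopf// invf_div mulrA divfK//.
by rewrite gt_eqF// int01_cole_hopf_num_gt0.
Qed.

Lemma m0_gt0_le : 0 < m0 e /\ forall x, I01 x -> m0 e <= e 0%N x.
Proof.
have [k k0 ke] := continuous01_min (eigenfun_continuous E 0%N) (fun x => @eigenfun0_gt0 _ _ _ _ E x).
have ne : [set e 0%N x | x in I01] !=set0 by exists (e 0%N 0); exists 0 => //; exact: I01_0.
split.
  apply: (lt_le_trans k0); apply: lb_le_inf => // _ [x Ix <-]; exact: ke.
move=> x Ix; apply: ge_inf; last by exists x.
by exists k => _ [y Iy <-]; exact: ke.
Qed.

(** The transform is positive with integral 1, so c_0 is an average of e_0. *)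
Lemma m0_le_coef0_cole_hopf u : L2 u -> m0 e <= coef e 0 (cole_hopf u).
Proof.
move=> lu; have [m00 mP] := m0_gt0_le; have cH := cole_hopf_continuous lu.
rewrite -[leLHS]mulr1 -(int01_cole_hopf lu) -int01Z; last exact: continuous01_integrable.
apply: le_int01.
- by apply: continuous01_integrable; exact: continuous01Z.
- by apply: continuous01_integrable; apply: continuous01M => //; exact: (eigenfun_continuous E).
- by move=> x Ix; rewrite ler_wpM2r ?mP// ltW// cole_hopf_gt0.
Qed.

(** The primitives of u and v differ by at most |v - u|_2. A comparison by factors, unlike one by
    differences, passes to integrals and to quotients. *)
Lemma cole_hopf_num_compare u v x : L2 u -> L2 v -> I01 x ->
  cole_hopf_num v x <= cole_hopf_num u x * expR (2^-1 * L2norm (v \- u)).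
Proof.
move=> lu lv Ix; rewrite !cole_hopf_numE -expRD ler_expR.
have := le_norm_primitive (L2B lv lu) Ix.
rewrite primitiveB//; [|exact: L2_integrable..].
rewrite -[L2norm (v \- u)]/(L2norm (fun y => v y - u y)).
by rewrite ler_norml => /andP[h _]; lra.
Qed.

Lemma L2norm_distC u v : L2 u -> L2 v -> L2norm (u \- v) = L2norm (v \- u).
Proof.
move=> lu lv; have := L2normZ (-1) (L2B lv lu); rewrite normrN1 mul1r => <-.
by apply: eq_L2norm => x _ /=; lra.
Qed.

(** The two-sided comparison a / k <= b <= k a becomes a distance because 1 - 1 / k <= k - 1 for k
    >= 1. *)
Lemma cole_hopf_num_dist u v x : L2 u -> L2 v -> I01 x ->
  `|cole_hopf_num v x - cole_hopf_num u x| <=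
  cole_hopf_num u x * (expR (2^-1 * L2norm (v \- u)) - 1).
Proof.
move=> lu lv Ix; have h1 := cole_hopf_num_compare lu lv Ix.
have := cole_hopf_num_compare lv lu Ix; rewrite L2norm_distC//.
move: h1; set d := L2norm _; have p1 := cole_hopf_num_gt0 u x; have p2 := cole_hopf_num_gt0 v x.
have d1 : 1 <= expR (2^-1 * d).
  by rewrite -expR0 ler_expR mulr_ge0// L2norm_ge0.
move: p1 p2 d1; move: (cole_hopf_num u x) (cole_hopf_num v x) (expR _) => a b k p1 p2 d1 h1 h2.
rewrite ler_norml; apply/andP; split; last by lra.
have [ba|ab] := leP b a; last by nra.
nra.
Qed.

(** One factor exp(|v - u|_2 / 2) comes from the numerator and one from the normalising integral. *)
Lemma cole_hopf_compare u v x : L2 u -> L2 v -> I01 x ->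
  cole_hopf v x <= cole_hopf u x * expR (L2norm (v \- u)).
Proof.
move=> lu lv Ix; rewrite /cole_hopf.
have pu := int01_cole_hopf_num_gt0 lu; have pv := int01_cole_hopf_num_gt0 lv.
set d := L2norm (v \- u); pose k := expR (2^-1 * d).
have k0 : 0 < k := expR_gt0 _.
have -> : expR d = k * k.
  by rewrite /k -expR_half.
have h : int01 (cole_hopf_num u) <= int01 (cole_hopf_num v) * k.
  rewrite mulrC -int01Z; last exact: (continuous01_integrable (cole_hopf_num_continuous lv)).
  apply: le_int01.
  - exact: (continuous01_integrable (cole_hopf_num_continuous lu)).
  - by apply: integrable01Z; exact: (continuous01_integrable (cole_hopf_num_continuous lv)).
  - move=> y Iy; rewrite mulrC; have := cole_hopf_num_compare lv lu Iy.
    by rewrite L2norm_distC.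
have h' := cole_hopf_num_compare lu lv Ix; rewrite -/d -/k in h'.
have p1 := cole_hopf_num_gt0 u x.
rewrite ler_pdivrMr//; apply: (le_trans h').
clear h'; clearbody k; move: pu h p1 k0; move: (cole_hopf_num u x) (int01 (cole_hopf_num u))
  (int01 (cole_hopf_num v)) k => a A B l pu h p1 k0.
have -> : a / A * (l * l) * B = (a * l) * ((B * l) / A) by lra.
by rewrite ler_peMr ?ler_pdivlMr ?mul1r// mulr_ge0 ?(ltW p1) ?(ltW k0).
Qed.

Lemma cole_hopf_dist u v x : L2 u -> L2 v -> I01 x ->
  `|cole_hopf v x - cole_hopf u x| <=
  cole_hopf u x * (expR (L2norm (v \- u)) - 1).
Proof.
move=> lu lv Ix; have h1 := cole_hopf_compare lu lv Ix.
have := cole_hopf_compare lv lu Ix; rewrite L2norm_distC//.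
move: h1; set d := L2norm _; have p1 := cole_hopf_gt0 x lu; have p2 := cole_hopf_gt0 x lv.
have d1 : 1 <= expR d by rewrite -expR0 ler_expR L2norm_ge0.
move: p1 p2 d1; move: (cole_hopf u x) (cole_hopf v x) (expR _) => a b k p1 p2 d1 h1 h2.
rewrite ler_norml; apply/andP; split; last by lra.
have [ba|ab] := leP b a; last by nra.
nra.
Qed.

Lemma cole_hopf_num_has_derive u x : continuous01 u -> I01 x ->
  has_derive01 (cole_hopf_num u) x (- (2^-1 * u x) * cole_hopf_num u x).
Proof.
move=> cu Ix; rewrite mulrC.
apply: (@has_derive01_comp _ expR (fun y => - (2^-1 * primitive u y))).
have := has_derive01Z (k := - 2^-1) (has_derive01_primitive cu Ix).
by rewrite mulNr; under eq_fun do rewrite mulNr.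
Qed.

End ColeHopf.

(** * Linearisation of the Burgers flow *)

#[local] Opaque cole_hopf_num.

Lemma is_derive_int_dominated {R : realType} (B : set R) (f df : R -> R -> R)
    (a b t C : R) :
  @measurable _ (measurableTypeR R) B -> B `<=` I01 -> a < t < b -> 0 <= C ->
  (forall s, a < s < b -> (@lebesgue_measure R).-integrable B (EFin \o f s)) ->
  (forall s y, a < s < b -> B y -> is_derive s 1 (f ^~ y) (df s y)) ->
  (forall s y, a < s < b -> B y -> `|df s y| <= C) ->
  is_derive t 1 (fun s => \int[@lebesgue_measure R]_(y in B) f s y)
    (\int[@lebesgue_measure R]_(y in B) df t y).
Proof.
move=> mB BI tab C0 intf fdf dfC.
have d1 s y : a < s < b -> B y -> partial1of2 f s y = df s y.
  by move=> sab By; rewrite partial1of2E; have [_ ->] := fdf s y sab By.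
have It : `]a, b[%classic t by rewrite /= in_itv.
have h1 s : `]a, b[%classic s -> (@lebesgue_measure R).-integrable B (EFin \o f s).
  by rewrite /= in_itv; exact: intf.
have h2 s y : `]a, b[%classic s -> B y -> derivable (f ^~ y) s 1.
  by rewrite /= in_itv => sab By; have [] := fdf s y sab By.
have h3 : (@lebesgue_measure R).-integrable B (EFin \o cst C).
  apply: (integrableS measurable_I01 mB BI).
  by apply: (@continuous01_integrable _ (cst C)); exact: continuous01_cst.
have h4 s y : `]a, b[%classic s -> B y -> `|partial1of2 f s y| <= cst C y.
  by rewrite /= in_itv => sab By; rewrite d1//; exact: dfC.
have D := derivable_under_integral mB It h1 h2 (fun=> C0) h3 h4.
have DE := differentiation_under_integral mB It h1 h2 (fun=> C0) h3 h4.
apply: DeriveDef; first exact: D.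
rewrite -derive1E DE; apply: eq_Rintegral => y /set_mem By.
exact: d1.
Qed.

(** Supplies the constants that dominate differentiation under the integral. The strip starts at a >
    0 because joint continuity is given for positive times only. *)
Lemma bounded_on_strip {R : realType} (f : R * R -> R) (a b : R) :
  0 < a -> {within `]0, +oo[ `*` I01, continuous f} ->
  exists2 M : R, 0 < M & forall s x, a <= s <= b -> I01 x -> `|f (s, x)| <= M.
Proof.
move=> a0 cf.
have sub : `[a, b] `*` (I01 : set R) `<=` `]0, +oo[ `*` I01.
  move=> [s x] [/= + Ix]; rewrite !in_itv/= => /andP[as_ _]; split => //=.
  by rewrite andbT (lt_le_trans a0 as_).
have cK : compact (`[a, b] `*` (I01 : set R)).
  by apply: compact_setX; exact: segment_compact.
have /compact_bounded[M [_ MP]] := continuous_compact (continuous_subspaceW sub cf) cK.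
exists (`|M| + 1); first by rewrite ltr_wpDl.
move=> s x sab Ix; apply: (MP (`|M| + 1)).
  by rewrite (le_lt_trans (ler_norm M))// ltrDl.
by exists (s, x) => //; split => //=; rewrite in_itv.
Qed.

Section Burgers.
Context {R : realType}.
Variables (V : R -> R) (mu : nat -> R) (e : nat -> R -> R).
Hypothesis smoothV : smooth01 V.
Hypothesis E : neumann_eigensystem V mu e.
Variables (u0 : R -> R) (u : R -> R -> R).
Hypothesis Lu0 : L2 u0.
Hypothesis S : burgers_solution V u0 u.
Implicit Types (s t x y : R) (n : nat).

Let phi t := cole_hopf_num (u t).

Lemma burgers_continuous t : 0 < t -> continuous01 (u t).
Proof.
by move=> t0; apply: derivable01_continuous; exact: (@burgers_smooth _ _ _ _ S _ t0 0%N).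
Qed.

Lemma burgers_has_derive t x : 0 < t -> I01 x ->
  has_derive01 (u t) x (derive01 (u t) x).
Proof. by move=> t0 Ix; apply: has_derive01P; exact: (@burgers_smooth _ _ _ _ S _ t0 0%N). Qed.

Lemma burgers_derive_continuous t : 0 < t -> continuous01 (derive01 (u t)).
Proof.
by move=> t0; apply: derivable01_continuous; exact: (@burgers_smooth _ _ _ _ S _ t0 1%N).
Qed.

Lemma burgers_has_derive2 t x : 0 < t -> I01 x ->
  has_derive01 (derive01 (u t)) x (derive01 (derive01 (u t)) x).
Proof. by move=> t0 Ix; apply: has_derive01P; exact: (@burgers_smooth _ _ _ _ S _ t0 1%N). Qed.

Lemma burgers_derive2_continuous t : 0 < t -> continuous01 (derive01 (derive01 (u t))).
Proof.
by move=> t0; apply: derivable01_continuous; exact: (@burgers_smooth _ _ _ _ S _ t0 2%N).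
Qed.

(* The equation is the conservation law [u_t = (flux)_x]. *)
Let flux t x := derive01 (u t) x - 2^-1 * u t x ^+ 2 + 2 * V x.

Lemma primitive_burgers_dt t x : 0 < t -> I01 x ->
  primitive (fun y => derive1 (u ^~ y) t) x = flux t x - flux t 0.
Proof.
move=> t0 Ix.
have ff y : I01 y -> has_derive01 (flux t) y (derive1 (u ^~ y) t).
  move=> Iy; have -> : derive1 (u ^~ y) t = derive01 (derive01 (u t)) y
      - 2^-1 * (derive01 (u t) y * u t y + u t y * derive01 (u t) y)
      + 2 * derive01 V y.
    have := burgers_eq S t0 Iy; lra.
  apply: has_derive01D.
    apply: has_derive01B; first exact: burgers_has_derive2.
    apply: has_derive01Z; under eq_fun do rewrite expr2.
    by apply: has_derive01M; exact: burgers_has_derive.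
  by apply: has_derive01Z; apply: has_derive01P; exact: (@smoothV 0%N).
have cd : continuous01 (derive01 (flux t)).
  have cdV : continuous01 (derive01 V).
    by apply: derivable01_continuous; exact: (@smoothV 1%N).
  have cu := burgers_continuous t0; have cu1 := burgers_derive_continuous t0.
  apply: (@eq_continuous01 _ (fun y => derive01 (derive01 (u t)) y
      - u t y * derive01 (u t) y + 2 * derive01 V y)).
    move=> y Iy; rewrite (has_derive01_unique Iy (ff y Iy)).
    have := burgers_eq S t0 Iy; lra.
  apply: continuous01D; last exact: continuous01Z.
  by apply: continuous01B; [exact: burgers_derive2_continuous|exact: continuous01M].
rewrite -(ftc01 (fun y Iy => has_derive01_derivable (ff y Iy)) cd Ix).
by apply: eq_primitive => // y Iy; rewrite (has_derive01_unique Iy (ff y Iy)).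
Qed.

Lemma is_derive_primitive_burgers t x : 0 < t -> I01 x ->
  is_derive t 1 (fun s => primitive (u s) x) (flux t x - flux t 0).
Proof.
move=> t0 Ix; rewrite -primitive_burgers_dt//.
(* Domination is required on a whole interval of times around t; ]t/2, t + 1[ stays away from 0. *)
have t20 : 0 < t / 2 by rewrite divr_gt0.
have [C C0 CP] := bounded_on_strip (t + 1) t20 (burgers_ct S).
have pos s : t / 2 < s < t + 1 -> 0 < s by move=> /andP[h _]; exact: lt_trans h.
apply: (is_derive_int_dominated (a := t / 2) (b := t + 1) (C := C)
   (df := fun s y => derive1 (u ^~ y) s)).
- exact: measurable_itv.
- exact: subset_0x.
- by apply/andP; split; lra.
- exact: ltW.
- move=> s /pos s0.
  apply: (integrableS measurable_I01 (measurable_itv _) (subset_0x Ix)).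
  exact: (continuous01_integrable (burgers_continuous s0)).
- move=> s y /pos s0 /(subset_0x Ix) Iy; rewrite derive1E.
  by apply: derivableP; exact: (burgers_dt S).
- move=> s y /andP[? ?] /(subset_0x Ix) Iy; apply: (CP s y) => //.
  by apply/andP; split; exact: ltW.
Qed.

Lemma is_derive_burgers_phi t x : 0 < t -> I01 x ->
  is_derive t 1 (fun s => phi s x) (- (2^-1 * (flux t x - flux t 0)) * phi t x).
Proof.
move=> t0 Ix; rewrite mulrC.
have H := is_derive_primitive_burgers t0 Ix.
have -> : phi^~ x = expR \o (fun s => - (2^-1 * primitive (u s) x)).
  by apply/funext => s; exact: cole_hopf_numE.
by rewrite /phi cole_hopf_numE; exact: is_derive1_comp.
Qed.

Let phi1 t x := - (2^-1 * u t x) * phi t x.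
Let phi2 t x := - (2^-1 * derive01 (u t) x) * phi t x
  + - (2^-1 * u t x) * phi1 t x.

Lemma burgers_phi_has_derive t x : 0 < t -> I01 x -> has_derive01 (phi t) x (phi1 t x).
Proof. by move=> t0 Ix; apply: cole_hopf_num_has_derive => //; exact: burgers_continuous. Qed.

Lemma burgers_phi_has_derive2 t x : 0 < t -> I01 x -> has_derive01 (phi1 t) x (phi2 t x).
Proof.
move=> t0 Ix; apply: has_derive01M; last exact: burgers_phi_has_derive.
have := has_derive01Z (k := - 2^-1) (burgers_has_derive t0 Ix).
by rewrite mulNr; under eq_fun do rewrite mulNr.
Qed.

Lemma burgers_phi_continuous t : 0 < t -> continuous01 (phi t).
Proof.
by move=> t0; apply: derivable01_continuous => x /(burgers_phi_has_derive t0); exact: has_derive01_derivable.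
Qed.

Lemma burgers_phi2_continuous t : 0 < t -> continuous01 (phi2 t).
Proof.
move=> t0; have c0 := burgers_continuous t0; have c1 := burgers_derive_continuous t0.
have cp := burgers_phi_continuous t0.
have N f : continuous01 f -> continuous01 (fun x => - (2^-1 * f x) : R).
  move=> cf; have := continuous01Z (k := - 2^-1) cf.
  by under eq_fun do rewrite mulNr.
apply: continuous01D; first by apply: continuous01M => //; exact: N.
by apply: continuous01M; [exact: N|apply: continuous01M => //; exact: N].
Qed.

Lemma burgers_coef_integrable n t : 0 < t -> integrable01 (fun x => e n x * phi t x).
Proof.
move=> t0; apply: continuous01_integrable; apply: continuous01M.
  exact: (eigenfun_continuous E).
exact: burgers_phi_continuous.
Qed.

(** The rate contains the flux at x = 0 because phi is normalised to 1 there. This part does not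
    depend on n and later cancels between two coefficients. *)
Lemma is_derive_burgers_coef n t : 0 < t ->
  is_derive t 1 (fun s => coef e n (phi s))
    ((- mu n + 2^-1 * flux t 0) * coef e n (phi t)).
Proof.
move=> t0; pose d s x := e n x * (- (2^-1 * (flux s x - flux s 0)) * phi s x).
have cV := potential_continuous smoothV.
have -> : (- mu n + 2^-1 * flux t 0) * coef e n (phi t) = int01 (d t).
  have p2 := fun x Ix => @burgers_phi_has_derive2 t x t0 Ix.
  have p1 := fun x Ix => @burgers_phi_has_derive t x t0 Ix.
  have [u_0 u_1] := burgers_bc S t0.
  have := @coef_schroedinger R V mu e smoothV E (phi t) (phi1 t) (phi2 t) p1 p2 (burgers_phi2_continuous t0).
  have p10 : phi1 t 0 = 0 by rewrite /phi1 u_0 mulr0 oppr0 mul0r.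
  have p11 : phi1 t 1 = 0 by rewrite /phi1 u_1 mulr0 oppr0 mul0r.
  move=> /(_ p10 p11 n).
  have i1 := burgers_coef_integrable n t0.
  have i2 : integrable01 (fun x => e n x * (phi2 t x - V x * phi t x)).
    apply: continuous01_integrable; apply: continuous01M; first exact: (eigenfun_continuous E).
    apply: continuous01B; first exact: burgers_phi2_continuous.
    by apply: continuous01M => //; exact: burgers_phi_continuous.
  rewrite mulrDl mulNr => <-; rewrite /coef -int01Z// -int01D//; last exact: integrable01Z.
  (* Pointwise this is the Cole-Hopf identity phi_t = phi'' - V phi + (1/2) flux(t, 0) phi. *)
  apply: eq_int01 => x _; rewrite /d /phi2 /phi1 /flux u_0.
  move: (phi t x) (derive01 (u t) x) (derive01 (u t) 0) (u t x) (V x) => a b c f g; lra.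
have t20 : 0 < t / 2 by rewrite divr_gt0.
have [M M0 VM] := continuous01_bounded cV.
have [K K0 eK] := continuous01_bounded (eigenfun_continuous E n).
have [C0 C00 CP0] := bounded_on_strip (t + 1) t20 (burgers_c0 S).
have [C1 C10 CP1] := bounded_on_strip (t + 1) t20 (burgers_c1 S).
pose F := C1 + 2^-1 * C0 ^+ 2 + 2 * M.
have pos s : t / 2 < s < t + 1 -> 0 < s by move=> /andP[h _]; exact: lt_trans h.
have fluxF s x : t / 2 < s < t + 1 -> I01 x -> `|flux s x| <= F.
  move=> /andP[/ltW s1 /ltW s2] Ix; have h : t / 2 <= s <= t + 1 by rewrite s1.
  rewrite (le_trans (ler_normD _ _))// lerD//; last first.
    by rewrite normrM ger0_norm// ler_wpM2l// VM.
  rewrite (le_trans (ler_normB _ _))// lerD//; first exact: (CP1 s x h Ix).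
  rewrite normrM ger0_norm ?invr_ge0// ler_wpM2l ?invr_ge0// normrX.
  by rewrite lerXn2r ?nnegrE ?(ltW C00)//; exact: (CP0 s x h Ix).
have F0 : 0 <= F by rewrite /F !addr_ge0 ?mulr_ge0 ?invr_ge0 ?ltW// exprn_gt0.
(* Dominating constant: K for e_n, F for half the difference of two fluxes, and exp(C0 / 2) for phi,
   since |u| <= C0. *)
apply: (@is_derive_int_dominated R I01 (fun s x => e n x * phi s x) d
  (t / 2) (t + 1) t (K * (F * expR (2^-1 * C0)))).
- exact: measurable_I01.
- by [].
- by apply/andP; split; lra.
- by rewrite !mulr_ge0 ?(ltW K0) ?expR_ge0.
- by move=> s /pos; exact: burgers_coef_integrable.
- move=> s x /pos s0 Ix; have := is_deriveZ (e n x) (is_derive_burgers_phi s0 Ix).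
  by [].
- move=> s x hs Ix; have s0 := pos s hs.
  rewrite /d normrM ler_pM// ?eK// normrM ler_pM//.
    rewrite normrN normrM ger0_norm ?invr_ge0//.
    have := fluxF s x hs Ix; have := fluxF s 0 hs I01_0.
    have := ler_normB (flux s x) (flux s 0).
    move: `|flux s x| `|flux s 0| `|flux s x - flux s 0| => a b c; lra.
  rewrite /phi cole_hopf_numE ger0_norm ?expR_ge0// ler_expR.
  have h : L2norm (u s) <= C0.
    apply: L2norm_bounded; [exact: (burgers_L2 S (ltW s0))|exact: ltW|].
    by move: hs => /andP[/ltW s1 /ltW s2] y Iy; apply: (CP0 s y) => //; rewrite s1.
  have := le_norm_primitive (burgers_L2 S (ltW s0)) Ix.
  rewrite /primitive ler_norml => /andP[+ _]; move: h.
  move: (L2norm _) (Rintegral _ _ _) => a b; lra.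
Qed.

Lemma burgers_coef0_gt0 t : 0 < t -> 0 < coef e 0 (phi t).
Proof.
move=> t0; apply: (coef0_gt0 E); first exact: burgers_phi_continuous.
by move=> x _; exact: cole_hopf_num_gt0.
Qed.

(** The coefficient ratio with its expected decay undone: the quantity that the flow conserves. *)
Let rho n t := expR ((mu n - mu 0%N) * t) * (coef e n (phi t) / coef e 0 (phi t)).

Lemma is_derive_burgers_ratio n t : 0 < t -> is_derive t 1 (rho n) 0.
Proof.
move=> t0; have c0 := burgers_coef0_gt0 t0.
have dn := is_derive_burgers_coef n t0; have d0 := is_derive_burgers_coef 0 t0.
have di := is_deriveV (lt0r_neq0 c0) d0.
have dq : is_derive t 1 (fun s => coef e n (phi s) / coef e 0 (phi s)) _ :=
  is_deriveM dn di.
have dE : is_derive t 1 (fun s => expR ((mu n - mu 0%N) * s))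
    (expR ((mu n - mu 0%N) * t) * (mu n - mu 0%N)).
  apply: (@is_derive1_comp _ expR (fun s => (mu n - mu 0%N) * s)).
  have := is_deriveZ (mu n - mu 0%N) (is_derive_id t 1).
  by rewrite /GRing.scale /= mulr1.
have := is_deriveM dE dq; move=> /is_derive_eq; apply.
rewrite /GRing.scale /= -exprVn.
have i2 : (coef e 0 (phi t))^-1 ^+ 2 * coef e 0 (phi t) = (coef e 0 (phi t))^-1.
  by rewrite expr2 mulfVK// gt_eqF.
move: i2; move: (coef e 0 (phi t)) (coef e n (phi t)) (expR _) (flux t 0) => a b c g.
move: (a^-1) => i i2.
(* The derivative is this multiple of i - i^2 a, which vanishes because i is the inverse of a; the
   remaining equality is polynomial. *)
rewrite [RHS](_ : _ = c * b * (- mu 0%N + 2^-1 * g) * (i - i ^+ 2 * a)); last first.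
  by rewrite i2 subrr mulr0.
lra.
Qed.

Lemma burgers_ratio_constant n s t : 0 < s -> s <= t -> rho n s = rho n t.
Proof.
move=> s0; rewrite le_eqVlt => /predU1P[->//|st].
have H x : x \in `]s, t[ -> is_derive x 1 (rho n) (cst 0 x).
  by rewrite in_itv/= => /andP[sx _]; apply: is_derive_burgers_ratio; exact: lt_trans sx.
have cr : {within `[s, t], continuous (rho n)}.
  apply: derivable_within_continuous => x; rewrite in_itv/= => /andP[sx _].
  by have [] := is_derive_burgers_ratio n (lt_le_trans s0 sx).
have [c _] := MVT st H cr.
move: (rho n t) (rho n s) => y z; rewrite /cst mul0r => /eqP.
by rewrite subr_eq0 => /eqP.
Qed.

(** * Passage to the initial time *)

Lemma burgers_L2norm_cvg0 : L2norm (u s \- u 0) @[s --> 0^'+] --> (0 : R).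
Proof.
move=> A /(burgers_cvg S (lexx 0)) H.
have {}H : nbhs 0 (fun s => 0 <= s -> A (L2norm (u s \- u 0))) := H.
suff : nbhs 0 (fun s => 0 < s -> A (L2norm (u s \- u 0))) by [].
by apply: filterS H => s h /ltW; exact: h.
Qed.

(** At t = 0 only convergence in L2 is available. The comparison by factors bounds phi(s) - phi(0)
    by phi(0) times a number tending to 0. *)
Lemma burgers_coef_cvg n : coef e n (phi s) @[s --> 0^'+] --> coef e n (phi 0).
Proof.
have L0 := burgers_L2 S (lexx 0).
have c0 := cole_hopf_num_continuous L0.
have K : L2norm (phi 0) * (expR (2^-1 * L2norm (u s \- u 0)) - 1) @[s --> 0^'+] --> (0 : R).
  suff : L2norm (phi 0) * (expR (2^-1 * L2norm (u s \- u 0)) - 1) @[s --> 0^'+]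
      --> L2norm (phi 0) * (expR (2^-1 * 0) - 1) by rewrite mulr0 expR0 subrr mulr0.
  apply: cvgM; first exact: cvg_cst.
  apply: cvgB; last exact: cvg_cst.
  apply: continuous_cvg; first exact: continuous_expR.
  by apply: cvgM; [exact: cvg_cst|exact: burgers_L2norm_cvg0].
apply/cvgrPdist_lt => eps eps0; move/cvgrPdist_lt : K => /(_ eps eps0) K.
near=> s; have s0 : 0 < s by near: s; exact: nbhs_right_gt.
have Ls := burgers_L2 S (ltW s0).
have cs := cole_hopf_num_continuous Ls.
have le := eigenfun_L2 E n.
have lp0 := continuous01_L2 c0; have lps := continuous01_L2 cs.
have : `|0 - L2norm (phi 0) * (expR (2^-1 * L2norm (u s \- u 0)) - 1)| < eps by near: s.
rewrite sub0r normrN; apply: le_lt_trans.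
rewrite (le_trans _ (ler_norm _))// /coef -int01B; last 2 first.
- exact: (L2_integrableM le lp0).
- exact: (L2_integrableM le lps).
rewrite (@eq_int01 _ _ (fun x => e n x * (phi 0 x - phi s x))); last by move=> x _; lra.
have ld : L2 (fun x => phi 0 x - phi s x) by exact: (L2B lp0 lps).
apply: (le_trans (cauchy_schwarz01 le ld)).
rewrite (eigenfun_L2norm E) mul1r.
have d1 : 0 <= expR (2^-1 * L2norm (u s \- u 0)) - 1.
  by rewrite subr_ge0 -expR0 ler_expR mulr_ge0// L2norm_ge0.
rewrite mulrC -[X in X * _](ger0_norm d1) -(L2normZ _ lp0).
apply: (L2norm_le_pointwise ld (L2Z _ lp0)).
move=> x Ix; rewrite distrC (le_trans (cole_hopf_num_dist L0 Ls Ix))//.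
by rewrite mulrC ler_norm.
Unshelve. all: by end_near. Qed.

(** [u 0] and [u0] agree almost everywhere only, but primitives do not see the difference. *)
Lemma cole_hopf_num_init x : I01 x -> phi 0 x = cole_hopf_num u0 x.
Proof.
move=> Ix; rewrite /phi !cole_hopf_numE; congr (expR (- (2^-1 * _))).
have sub := subset_0x Ix; have mx := @measurable_itv R `[0, x].
rewrite /primitive /Rintegral; congr fine; apply: ae_eq_integral => //.
- move/measurable_int : (L2_integrable (burgers_L2 S (lexx 0))).
  exact: (measurable_funS measurable_I01 sub).
- move/measurable_int : (L2_integrable Lu0).
  exact: (measurable_funS measurable_I01 sub).
- have aeF := ae_filter_ringOfSetsType (@lebesgue_measure R).
  have := burgers_init S; apply: filterS => y h /sub Iy /=.
  by rewrite h.
Qed.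

(** [rho] is constant on positive times and has a right limit at 0 computed from the datum, so its
    constant value is that limit. *)
Lemma burgers_coef_ratio n t : 0 < t ->
  coef e n (phi t) = coef e 0 (phi t) *
    (expR (- ((mu n - mu 0%N) * t)) * (coef e n (cole_hopf u0) / coef e 0 (cole_hopf u0))).
Proof.
move=> t0; have L0 := burgers_L2 S (lexx 0).
have c00 : 0 < coef e 0 (phi 0).
  apply: (coef0_gt0 E); first exact: cole_hopf_num_continuous.
  by move=> x _; exact: cole_hopf_num_gt0.
have h1 : rho n s @[s --> 0^'+] --> expR ((mu n - mu 0%N) * 0) * (coef e n (phi 0) / coef e 0 (phi 0)).
  apply: cvgM.
    apply: continuous_cvg; first exact: continuous_expR.
    apply: cvgM; first exact: cvg_cst.
    by apply: cvg_within_filter; exact: cvg_id.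
  apply: cvgM; first exact: burgers_coef_cvg.
  by apply: cvgV; [exact: lt0r_neq0|exact: burgers_coef_cvg].
have h2 : rho n s @[s --> 0^'+] --> rho n t.
  have cc (z : R) : cst z s @[s --> (0 : R)^'+] --> z by exact: cvg_cst.
  have := cc (rho n t).
  apply: cvg_trans; apply: near_eq_cvg; near=> s.
  rewrite /cst; symmetry; apply: burgers_ratio_constant; first by near: s; exact: nbhs_right_gt.
  by near: s; exact: nbhs_right_le.
have H : rho n t = coef e n (phi 0) / coef e 0 (phi 0).
  rewrite mulr0 expR0 mul1r in h1.
  move: h2 h1; move: (rho n t) (coef e n (phi 0) / coef e 0 (phi 0)) (rho n) => a b g h2 h1.
  exact: (cvg_unique (@Rhausdorff R) h2 h1).
have ratio : coef e n (cole_hopf u0) / coef e 0 (cole_hopf u0) = rho n t.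
  apply: etrans (esym H); rewrite (coef_cole_hopf_ratio E n Lu0).
  have cE m : coef e m (cole_hopf_num u0) = coef e m (phi 0).
    by apply: eq_int01 => x Ix; rewrite cole_hopf_num_init.
  exact: (f_equal2 (fun a b => a / b) (cE n) (cE 0%N)).
suff h : coef e n (phi t) = coef e 0 (phi t) * (expR (- ((mu n - mu 0%N) * t)) * rho n t).
  apply: (etrans h).
  exact: (congr1 (fun z => coef e 0 (phi t) * (expR (- ((mu n - mu 0%N) * t)) * z)) (esym ratio)).
rewrite /rho; have := burgers_coef0_gt0 t0.
move: (coef e 0 (phi t)) (coef e n (phi t)) => a b a0.
by rewrite [X in a * X]mulrA -expRD addNr expR0 mul1r mulrCA divff ?mulr1// gt_eqF.
Unshelve. all: by end_near. Qed.

(** Division by c_0(phi(t)) removes the one factor that the datum does not yet determine. The number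
    p = phi(t, x) / c_0(phi(t)) is left unspecified; it is common to both limits and drops out of
    their quotient. *)
Lemma burgers_eigen_expansion t x : 0 < t -> I01 x ->
  let A k := expR (- ((mu k - mu 0%N) * t)) * (coef e k (cole_hopf u0) / coef e 0 (cole_hopf u0)) in
  exists2 p : R, 0 < p &
   \sum_(k < m) A k * e k x @[m --> \oo] --> p /\
   \sum_(k < m) A k * derive01 (e k) x @[m --> \oo] --> - (2^-1 * u t x) * p.
Proof.
move=> t0 Ix A; have c0 := burgers_coef0_gt0 t0.
have [u_0 u_1] := burgers_bc S t0.
have p2 := fun x Ix => @burgers_phi_has_derive2 t x t0 Ix.
have p1 := fun x Ix => @burgers_phi_has_derive t x t0 Ix.
have p10 : phi1 t 0 = 0 by rewrite /phi1 u_0 mulr0 oppr0 mul0r.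
have p11 : phi1 t 1 = 0 by rewrite /phi1 u_1 mulr0 oppr0 mul0r.
have [h1 h2] := @eigen_expansion_cvg R V mu e smoothV E (phi t) (phi1 t) (phi2 t) p1 p2
  (burgers_phi2_continuous t0) p10 p11 x Ix.
exists (phi t x / coef e 0 (phi t)); first by rewrite divr_gt0// cole_hopf_num_gt0.
have AE k : A k = coef e k (phi t) / coef e 0 (phi t).
  by rewrite burgers_coef_ratio// mulrAC divff ?mul1r// gt_eqF.
have R1 (g : nat -> R) m : \sum_(k < m) A k * g k =
    (\sum_(k < m) coef e k (phi t) * g k) / coef e 0 (phi t).
  by rewrite mulr_suml; apply: eq_bigr => k _; rewrite AE mulrAC.
split.
  under eq_fun do rewrite (R1 (fun k => e k x)).
  by apply: cvgM => //; exact: cvg_cst.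
under eq_fun do rewrite (R1 (fun k => derive01 (e k) x)).
by rewrite mulrA; apply: cvgM => //; exact: cvg_cst.
Qed.

End Burgers.

(** * Unordered sums over multi-indices *)

Section Words.
Implicit Types (s : seq nat) (w : seq nat) (m N : nat).

Fixpoint words_upto s m : seq (seq nat) :=
  if m is m'.+1 then [::] :: [seq q :: w | q <- s, w <- words_upto s m']
  else [:: [::]].

Lemma mem_words_upto s m w :
  (w \in words_upto s m) = (size w <= m)%N && all (mem s) w.
Proof.
elim: m w => [|m ih] [|q w] //=.
rewrite in_cons /=; apply/allpairsP/idP => [[[p v] /= [ps vm [-> ->]]]|].
  by move: vm; rewrite ih => /andP[vm ->]; rewrite ltnS vm ps.
by rewrite ltnS => /and3P[wm qs ws]; exists (q, w); split => //; rewrite ih wm.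
Qed.

Lemma words_upto_uniq s m : uniq s -> uniq (words_upto s m).
Proof.
move=> us; elim: m => [//|m ih] /=; apply/andP; split.
  by apply/allpairsP => -[[q w] [_ _]].
by apply: allpairs_uniq => // -[q w] [p v] _ _ [-> ->].
Qed.

(** Finite geometric series: the words of length k are the monomials of the k-th power of the sum of
    f, multiplied out. *)
Lemma sum_words_upto {R : comRingType} s m (f : nat -> R) :
  (1 - \sum_(q <- s) f q) * \sum_(w <- words_upto s m) \prod_(q <- w) f q =
  1 - (\sum_(q <- s) f q) ^+ m.+1.
Proof.
elim: m => [|m ih] /=; first by rewrite big_seq1 big_nil mulr1 expr1.
rewrite big_cons big_nil big_allpairs_dep /=.
have -> : \sum_(q <- s) \sum_(w <- words_upto s m) \prod_(p <- q :: w) f p =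
    \sum_(q <- s) f q * \sum_(w <- words_upto s m) \prod_(p <- w) f p.
  by apply: eq_bigr => q _; rewrite mulr_sumr; apply: eq_bigr => w _; rewrite big_cons.
rewrite -mulr_suml mulrDr mulr1 mulrCA ih mulrBr mulr1 -exprS.
by rewrite addrA subrK.
Qed.

(** Heads below N with words of at most N letters from 1 to N. Being a product set, it lets the sum
    of a product term factorise. *)
Definition index_box N : seq (nat * seq nat) :=
  [seq (q, w) | q <- iota 0 N, w <- words_upto (iota 1 N) N].

Lemma index_box_uniq N : uniq (index_box N).
Proof.
apply: allpairs_uniq; [exact: iota_uniq|exact: words_upto_uniq (iota_uniq _ _)|].
by move=> [q w] [p v] _ _ [-> ->].
Qed.

Lemma mem_index_box N (nu : nat * seq nat) : nu \in index_box N ->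
  (forall q, q \in nu.2 -> (0 < q)%N).
Proof.
case/allpairsP => -[q w] /= [_ + ->] /=.
rewrite mem_words_upto => /andP[_ /allP wN] p /wN.
by rewrite /= mem_iota => /andP[].
Qed.

(** One number bounds the head, the length and every letter, so a finite set of indices lies in all
    large boxes. *)
Lemma in_index_box N (nu : nat * seq nat) :
  (forall q, q \in nu.2 -> (0 < q)%N) ->
  (nu.1 + size nu.2 + sumn nu.2 < N)%N -> nu \in index_box N.
Proof.
case: nu => q w /= wpos h; apply/allpairsP; exists (q, w); split => //=.
  by rewrite mem_iota /= add0n; lia.
rewrite mem_words_upto; apply/andP; split; first by lia.
apply/allP => p pw /=; rewrite mem_iota wpos//= add1n ltnS.
have : (p <= sumn w)%N by rewrite sumnE (big_rem p)//= leq_addr.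
by lia.
Qed.

Lemma sum_index_box {R : comRingType} N (d f : nat -> R) :
  \sum_(nu <- index_box N) d nu.1 * \prod_(q <- nu.2) f q =
  (\sum_(q < N) d q) *
    \sum_(w <- words_upto (iota 1 N) N) \prod_(q <- w) f q.
Proof.
rewrite big_allpairs_dep /= mulr_suml -(big_mkord xpredT (fun q => d q * _)) /=.
rewrite /index_iota subn0; apply: eq_bigr => q _.
by rewrite mulr_sumr.
Qed.

End Words.

(** * Families with a summable majorant *)

Section AbsoluteSum.
Context {R : realType} {T : choiceType}.
Variables (D : set T) (F b : T -> R) (C : R).
Hypothesis b_ge0 : forall x, D x -> 0 <= b x.
Hypothesis b_le : forall A, fsets D A -> \sum_(x \in A) b x <= C.

Lemma fsum_setD (G : T -> R) (A0 A : set T) : finite_set A -> A0 `<=` A ->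
  \sum_(x \in A) G x - \sum_(x \in A0) G x = \sum_(x \in A `&` ~` A0) G x.
Proof.
move=> fA sA; rewrite [X in X - _](fsbigID A0)//=.
by rewrite (setIidr sA) addrAC subrr add0r.
Qed.

Lemma esum_lty (a : T -> \bar R) : (forall x, D x -> (0 <= a x <= (b x)%:E)%E) ->
  (\esum_(x in D) a x < +oo)%E.
Proof.
move=> ab; apply: (@le_lt_trans _ _ C%:E); last by rewrite ltry.
apply: ub_ereal_sup => _ [A [fA AD] <-].
apply: (@le_trans _ _ (\sum_(x \in A) (b x)%:E)%E).
  rewrite !fsbig_finite//=; rewrite big_seq [leRHS]big_seq; apply: lee_sum => x.
  by rewrite in_fset_set// => /set_mem /AD /ab /andP[].
by rewrite fsumEFin// lee_fin; apply: b_le.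
Qed.

(** A0 nearly attains the supremum of the finite sums of b, so a larger finite set changes the sum
    of F by less than eps / 3. It remains to compare A with A0, A0 with a late [s N], and [s N] with
    l. *)
Lemma has_sum_exhaustion (s : nat -> seq T) (l : R) :
  (forall x, D x -> `|F x| <= b x) ->
  (forall N, uniq (s N)) -> (forall N x, x \in s N -> D x) ->
  (forall A, fsets D A -> exists N0, forall N, (N0 <= N)%N -> A `<=` [set` s N]) ->
  \sum_(x <- s N) F x @[N --> \oo] --> l -> has_sum D F l.
Proof.
move=> Fb us sD sA sl eps eps0.
pose E := [set \sum_(x \in A) b x | A in fsets D].
have E0 : E !=set0 by exists (\sum_(x \in set0) b x); exists set0 => //; split.
have supE : has_sup E.
  by split => //; exists C => _ [A DA <-]; exact: b_le.
have e30 : 0 < eps / 3 by rewrite divr_gt0.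
have [_ [A0 [fA0 A0D] <-] hA0] := sup_adherent e30 supE.
exists A0; first by split.
have key A : fsets D A -> A0 `<=` A ->
    `|\sum_(x \in A) F x - \sum_(x \in A0) F x| < eps / 3.
  move=> [fA AD] A0A; rewrite fsum_setD//.
  have bA : \sum_(x \in A) b x <= sup E.
    by apply: sup_upper_bound => //; exists A.
  have : \sum_(x \in A) b x - \sum_(x \in A0) b x < eps / 3 by lra.
  apply: le_lt_trans; rewrite fsum_setD//.
  have fI : finite_set (A `&` ~` A0) by exact: finite_setIl.
  rewrite !fsbig_finite//=; apply: (le_trans (ler_norm_sum _ _ _)).
  rewrite big_seq [leRHS]big_seq; apply: ler_sum => x.
  by rewrite in_fset_set// => /set_mem [/AD Dx _]; exact: Fb.
move=> A [fA AD] A0A.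
have [N0 N0P] := sA A0 (conj fA0 A0D).
move/cvgrPdist_lt : sl => /(_ _ e30) [N1 _ N1P].
pose N := maxn N0 N1.
have h1 := N1P N (leq_maxr _ _); rewrite /= in h1.
have h2 := key A (conj fA AD) A0A.
have h3 : `|\sum_(x <- s N) F x - \sum_(x \in A0) F x| < eps / 3.
  rewrite fsbig_seq//; apply: key; last exact: (N0P N (leq_maxl _ _)).
  by split; [exact: finite_seq|move=> x; exact: sD].
move: h1 h2 h3; rewrite !ltr_norml => /andP[? ?] /andP[? ?] /andP[? ?].
by apply/andP; split; lra.
Qed.

End AbsoluteSum.

(** * Summation over heads and words *)

Section KoopmanSum.
Context {R : realType}.
Variables (d f bd bf : nat -> R) (K rho : R).
Hypothesis d_le : forall q, `|d q| <= bd q.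
Hypothesis f_le : forall q, (0 < q)%N -> `|f q| <= bf q.
Hypothesis bd_sum : forall N, \sum_(q < N) bd q <= K.
Hypothesis bf_sum : forall N, \sum_(q <- iota 1 N) bf q <= rho.
Hypothesis rho_lt1 : rho < 1.

Let F (nu : nat * seq nat) := d nu.1 * \prod_(q <- nu.2) f q.
Let b (nu : nat * seq nat) := bd nu.1 * \prod_(q <- nu.2) bf q.

Let bd_ge0 q : 0 <= bd q. Proof. exact: le_trans (d_le q). Qed.

Let bf_ge0 q : (0 < q)%N -> 0 <= bf q.
Proof. by move=> /f_le; exact: le_trans. Qed.

Lemma geometric_word_sum N (g : nat -> R) : \sum_(q <- iota 1 N) g q != 1 ->
  \sum_(w <- words_upto (iota 1 N) N) \prod_(q <- w) g q =
  (1 - (\sum_(q <- iota 1 N) g q) ^+ N.+1) / (1 - \sum_(q <- iota 1 N) g q).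
Proof.
move=> g1; rewrite -(sum_words_upto (iota 1 N) N g) mulrAC divff ?mul1r//.
by rewrite subr_eq0 eq_sym.
Qed.

Lemma koopman_bound_ge0 nu : koopman_index nu -> 0 <= b nu.
Proof.
move=> nuI; rewrite mulr_ge0//; rewrite big_seq; apply: prodr_ge0 => q /nuI.
exact: bf_ge0.
Qed.

Lemma koopman_term_le nu : koopman_index nu -> `|F nu| <= b nu.
Proof.
move=> nuI; rewrite normrM ler_pM// normr_prod.
rewrite big_seq [leRHS]big_seq; apply: ler_prod => q /nuI q0.
by rewrite normr_ge0 f_le.
Qed.

Lemma koopman_index_exhausted A : fsets koopman_index A ->
  exists N0, forall N, (N0 <= N)%N -> A `<=` [set` index_box N].
Proof.
move=> [fA AI]; pose h (nu : nat * seq nat) := (nu.1 + size nu.2 + sumn nu.2)%N.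
have [s As] := (finite_seqP _).1 fA.
exists (\max_(nu <- s) h nu).+1 => N hN nu Anu /=.
apply: in_index_box; first exact: AI.
apply: leq_trans hN; rewrite ltnS; apply: (@leq_bigmax_seq _ s xpredT h) => //.
by move: Anu; rewrite As.
Qed.

(** A finite set of indices lies in a box, where the majorant sums to at most K times a finite
    geometric series of ratio r <= rho. *)
Lemma koopman_bound_sum A : fsets koopman_index A ->
  \sum_(nu \in A) b nu <= K / (1 - rho).
Proof.
move=> AI; have [N /(_ N (leqnn N)) AN] := koopman_index_exhausted AI.
have [fA AD] := AI.
apply: (@le_trans _ _ (\sum_(nu <- index_box N) b nu)).
  apply: (@le_trans _ _ (\sum_(nu \in [set` index_box N]) b nu)); last first.
    by rewrite -fsbig_seq ?index_box_uniq.
  rewrite -subr_ge0 (fsum_setD b (finite_seq _) AN).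
  have fI : finite_set ([set` index_box N] `&` ~` A) by apply: finite_setIl; exact: finite_seq.
  rewrite fsbig_finite//= big_seq; apply: sumr_ge0 => nu.
  rewrite in_fset_set// => /set_mem [/= nuN _].
  by apply: koopman_bound_ge0; exact: mem_index_box nuN.
rewrite /b sum_index_box.
have r0 : 0 <= \sum_(q <- iota 1 N) bf q.
  by rewrite big_seq; apply: sumr_ge0 => q; rewrite mem_iota => /andP[/bf_ge0].
have r1 := bf_sum N.
rewrite geometric_word_sum; last by rewrite lt_eqF// (le_lt_trans r1).
set r := \sum_(q <- _) _ in r0 r1 *; clearbody r.
have r1' := le_lt_trans r1 rho_lt1.
have rN : 0 <= r ^+ N.+1 by rewrite exprn_ge0.
have K0 : 0 <= K by have := bd_sum 0; rewrite big_ord0.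
apply: ler_pM; rewrite ?bd_sum//.
- by apply: sumr_ge0 => q _.
- apply: divr_ge0; last by lra.
  by rewrite subr_ge0 exprn_ile1//; lra.
- apply: (@le_trans _ _ (1 / (1 - r))).
    by rewrite ler_wpM2r ?invr_ge0; lra.
  by rewrite div1r lef_pV2 ?posrE ?subr_gt0// lerD2l lerN2.
Qed.

Lemma koopman_has_sum (l z : R) : \sum_(q < N) d q @[N --> \oo] --> l ->
  \sum_(q <- iota 1 N) f q @[N --> \oo] --> z -> has_sum koopman_index F (l / (1 - z)).
Proof.
move=> dl fz.
have rhoN N : `|\sum_(q <- iota 1 N) f q| <= rho.
  apply: le_trans (bf_sum N); apply: (le_trans (ler_norm_sum _ _ _)).
  rewrite big_seq [leRHS]big_seq; apply: ler_sum => q; rewrite mem_iota => /andP[q0 _].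
  exact: f_le.
have rho0 : 0 <= rho := le_trans (normr_ge0 _) (rhoN 0%N).
have zrho : `|z| <= rho.
  apply: (ler_cvg_to (cvg_norm fz) (cvg_cst rho)); exact: nearW rhoN.
have z1 : z != 1.
  by apply: contraTneq zrho => ->; rewrite normr1 -ltNge.
apply: (has_sum_exhaustion koopman_bound_sum koopman_term_le index_box_uniq).
- by move=> N nu; exact: mem_index_box.
- exact: koopman_index_exhausted.
- under eq_fun do rewrite /F sum_index_box.
  have -> : l / (1 - z) = l * ((1 - 0) / (1 - z)) by rewrite subr0 div1r.
  apply: cvgM => //.
  have N1 N : \sum_(q <- iota 1 N) f q != 1.
    by apply: contraTneq (rhoN N) => ->; rewrite normr1 -ltNge.
  under eq_fun do rewrite geometric_word_sum//.
  apply: cvgM; last first.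
    by apply: cvgV; [rewrite subr_eq0 eq_sym|apply: cvgB => //; exact: cvg_cst].
  apply: cvgB; first exact: cvg_cst.
  (* Base and exponent both vary with N; the base is at most rho < 1 in absolute value, so
     [rho ^+ N] dominates. *)
  apply/cvgr0Pnorm_lt => eps eps0.
  have /cvgr0Pnorm_lt /(_ eps eps0) : rho ^+ N @[N --> \oo] --> (0 : R).
    by apply: cvg_expr; rewrite ger0_norm.
  apply: filterS => N; apply: le_lt_trans.
  rewrite normrX [leRHS]ger0_norm ?exprn_ge0// exprS.
  rewrite -[leRHS]mul1r; apply: ler_pM; rewrite ?exprn_ge0//.
    by rewrite (le_trans (rhoN N))// ltW.
  by rewrite lerXn2r// nnegrE.
Qed.

End KoopmanSum.

(** * The series h5 *)

Lemma cauchy_schwarz_seq {R : realFieldType} (s : seq nat) (a b : nat -> R) :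
  (\sum_(q <- s) a q * b q) ^+ 2 <= (\sum_(q <- s) a q ^+ 2) * \sum_(q <- s) b q ^+ 2.
Proof.
apply: discriminant_le0; first by apply: sumr_ge0 => q _; exact: sqr_ge0.
move=> k; rewrite [X in 0 <= X](_ : _ = \sum_(q <- s) (a q + k * b q) ^+ 2).
  by apply: sumr_ge0 => q _; exact: sqr_ge0.
rewrite !mulr_sumr -!big_split /=; apply: eq_bigr => q _; lra.
Qed.

Section HeatSeries.
Context {R : realType}.
Variables (V : R -> R) (mu : nat -> R) (e : nat -> R -> R).
Hypothesis smoothV : smooth01 V.
Hypothesis V_gt0 : forall x, I01 x -> 0 < V x.
Hypothesis E : neumann_eigensystem V mu e.
Implicit Types (s t c : R) (n q : nat).

Definition heat_term q t : R :=
  expR (- (2 * (mu q - mu 0%N) * t)) * (1 + Num.sqrt (mu q)) ^+ 2.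

Let S t : R := fine (\sum_(1 <= q <oo) (heat_term q t)%:E)%E.

Lemma h5E t : h5 mu t = Num.sqrt (S t). Proof. by []. Qed.

Lemma gap_ge0 q : 0 <= mu q - mu 0%N.
Proof. by rewrite subr_ge0 (eigenval_homo E). Qed.

Lemma gap_gt0 q : (0 < q)%N -> 0 < mu q - mu 0%N.
Proof.
move=> q0; rewrite subr_gt0 (lt_le_trans (eigenval_simple E))//.
exact: (eigenval_homo E).
Qed.

Lemma heat_term_ge0 q t : 0 <= heat_term q t.
Proof. by rewrite mulr_ge0 ?expR_ge0 ?sqr_ge0. Qed.

Lemma sqr_1_sqrt_le q : (1 + Num.sqrt (mu q)) ^+ 2 <= 2 * (1 + mu q).
Proof.
have := sqr_sqrtr (ltW (eigenval_ge0 E q)); have := sqr_ge0 (1 - Num.sqrt (mu q)).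
move: (Num.sqrt (mu q)) (mu q) => a m; nra.
Qed.

(** The second moment is more than the sum of [heat_term] requires; it also dominates the time
    derivative of that series, whence continuity. *)
Lemma heat_moment_bounded t : 0 < t -> exists2 K : R, 0 <= K &
  forall n, \sum_(1 <= q < n) (1 + mu q) ^+ 2 * expR (- (2 * (mu q - mu 0%N) * t)) <= K.
Proof.
move=> t0; have t20 : 0 < 2 * t by rewrite mulr_gt0.
have [K K0 KP] := eigenval_heat_moment smoothV V_gt0 E t20.
exists (expR (2 * t * mu 0%N) * K); first by rewrite mulr_ge0 ?expR_ge0.
move=> n; apply: (@le_trans _ _ (expR (2 * t * mu 0%N) *
    \sum_(q < n) (1 + mu q) ^+ 2 * expR (- (2 * t * mu q)))).
  have h q : 0 <= expR (2 * t * mu 0%N) * ((1 + mu q) ^+ 2 * expR (- (2 * t * mu q))).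
    apply: mulr_ge0; first exact: expR_ge0.
    by apply: mulr_ge0; [exact: sqr_ge0|exact: expR_ge0].
  rewrite mulr_sumr -(big_mkord xpredT (fun q => expR (2 * t * mu 0%N) *
    ((1 + mu q) ^+ 2 * expR (- (2 * t * mu q))))).
  case: n => [|n]; first by rewrite big_geq// big_nil.
  rewrite [leRHS]big_ltn// -[leLHS]add0r lerD// ?h//.
  apply: ler_sum => q _; rewrite le_eqVlt; apply/orP; left; apply/eqP.
  by rewrite mulrCA -expRD; congr (_ * expR _); lra.
by rewrite ler_wpM2l ?expR_ge0.
Qed.

Lemma heat_term_le q t : heat_term q t <=
  2 * ((1 + mu q) ^+ 2 * expR (- (2 * (mu q - mu 0%N) * t))).
Proof.
rewrite /heat_term mulrC mulrA ler_wpM2r ?expR_ge0// (le_trans (sqr_1_sqrt_le q))//.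
have := eigenval_ge0 E q; move: (mu q) => m m0; nra.
Qed.

Lemma heat_partial_bounded t : 0 < t -> exists2 K : R, 0 <= K &
  forall n, \sum_(1 <= q < n) heat_term q t <= K.
Proof.
move=> /heat_moment_bounded [K K0 KP]; exists (2 * K); first by rewrite mulr_ge0.
move=> n; apply: (@le_trans _ _ (2 * \sum_(1 <= q < n)
    (1 + mu q) ^+ 2 * expR (- (2 * (mu q - mu 0%N) * t)))).
  by rewrite mulr_sumr; apply: ler_sum => q _; exact: heat_term_le.
by rewrite ler_wpM2l.
Qed.

Lemma heat_series_le (B t : R) : (forall n, \sum_(1 <= q < n) heat_term q t <= B) ->
  (\sum_(1 <= q <oo) (heat_term q t)%:E <= B%:E)%E.
Proof.
move=> hB; apply: lime_le.
  by apply: is_cvg_nneseries => q _ _; rewrite lee_fin heat_term_ge0.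
by apply: nearW => n; rewrite sumEFin lee_fin.
Qed.

(** Excludes the value +oo, on which [fine] would return its default 0 and [h5] would lose its
    meaning. *)
Lemma heat_series_fin t : 0 < t ->
  (\sum_(1 <= q <oo) (heat_term q t)%:E)%E \is a fin_num.
Proof.
move=> /heat_partial_bounded [K _ KP]; rewrite ge0_fin_numE.
  exact: le_lt_trans (heat_series_le KP) (ltry _).
by apply: nneseries_ge0 => q _ _; rewrite lee_fin heat_term_ge0.
Qed.

Lemma heat_sum_le (B t : R) : 0 < t ->
  (forall n, \sum_(1 <= q < n) heat_term q t <= B) -> S t <= B.
Proof.
by move=> t0 /heat_series_le; rewrite -lee_fin /S fineK// heat_series_fin.
Qed.

Lemma heat_partial_le n t : 0 < t -> \sum_(1 <= q < n) heat_term q t <= S t.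
Proof.
move=> t0; rewrite -lee_fin /S fineK ?heat_series_fin// -sumEFin.
by apply: nneseries_lim_ge => q _ _; rewrite lee_fin heat_term_ge0.
Qed.

Lemma heat_sum_gt0 t : 0 < t -> 0 < S t.
Proof.
move=> t0; apply: lt_le_trans (heat_partial_le 2 t0); rewrite big_nat1.
by rewrite mulr_gt0 ?expR_gt0// exprn_gt0// ltr_wpDr// sqrtr_ge0.
Qed.

(** Each mode q >= 1 decays at least at the rate of the spectral gap mu_1 - mu_0. Both the strict
    decrease and the smallness at large times follow. *)
Lemma heat_sum_decay s t : 0 < s -> s <= t ->
  S t <= expR (- (2 * (mu 1%N - mu 0%N) * (t - s))) * S s.
Proof.
move=> s0 st; have t0 := lt_le_trans s0 st; apply: heat_sum_le => // n.
apply: (@le_trans _ _ (expR (- (2 * (mu 1%N - mu 0%N) * (t - s))) *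
   \sum_(1 <= q < n) heat_term q s)); last first.
  by rewrite ler_wpM2l ?expR_ge0// heat_partial_le.
rewrite mulr_sumr big_nat [leRHS]big_nat; apply: ler_sum => q /andP[q1 _].
rewrite /heat_term mulrA ler_wpM2r ?sqr_ge0// -expRD ler_expR.
have h : mu 1%N <= mu q by exact: (eigenval_homo E).
have : 0 <= (mu q - mu 1%N) * (t - s) by rewrite mulr_ge0 ?subr_ge0.
move: (mu q) (mu 1%N) (mu 0%N) => a b c; lra.
Qed.

Lemma heat_sum_ltr s t : 0 < s -> s < t -> S t < S s.
Proof.
move=> s0 st; apply: le_lt_trans (heat_sum_decay s0 (ltW st)) _.
rewrite -[ltRHS]mul1r ltr_pM2r ?heat_sum_gt0// -expR0 ltr_expR oppr_lt0.
by rewrite !mulr_gt0 ?subr_gt0//; exact: (eigenval_simple E).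
Qed.

Lemma h5_gt0 t : 0 < t -> 0 < h5 mu t.
Proof. by move=> t0; rewrite h5E sqrtr_gt0 heat_sum_gt0. Qed.

Lemma h5_sqr t : 0 < t -> h5 mu t ^+ 2 = S t.
Proof. by move=> t0; rewrite h5E sqr_sqrtr// ltW// heat_sum_gt0. Qed.

Lemma h5_ltr s t : 0 < s -> s < t -> h5 mu t < h5 mu s.
Proof. by move=> s0 st; rewrite !h5E ltr_sqrt ?heat_sum_gt0// heat_sum_ltr. Qed.

(** Termwise from 1 - exp(- y) <= y. The one-sided bound suffices because the sum decreases in
    time. *)
Lemma heat_sum_lipschitz (a : R) : 0 < a -> exists2 L : R, 0 <= L &
  forall s t, a <= s -> s <= t -> S s <= S t + L * (t - s).
Proof.
move=> a0; have [K K0 KP] := heat_moment_bounded a0.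
(* Twice the gap is at most 2 (1 + mu_q), and the weight (1 + sqrt mu_q)^2 is at most 2 (1 +
   mu_q). *)
exists (4 * K); first by rewrite mulr_ge0.
move=> s t as_ st; have s0 := lt_le_trans a0 as_; have t0 := lt_le_trans s0 st.
apply: heat_sum_le => // n.
apply: (@le_trans _ _ (\sum_(1 <= q < n) heat_term q t + 4 *
   (\sum_(1 <= q < n) (1 + mu q) ^+ 2 * expR (- (2 * (mu q - mu 0%N) * a))) * (t - s))); last first.
  apply: lerD; first exact: heat_partial_le.
  by rewrite ler_wpM2r ?subr_ge0// ler_wpM2l.
rewrite mulr_sumr mulr_suml -big_split /=; apply: ler_sum => q _.
set k := mu q - mu 0%N; have k0 : 0 <= k := gap_ge0 q.
have kq : k <= 1 + mu q by have := eigenval_ge0 E 0%N; rewrite /k; lra.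
have w := sqr_1_sqrt_le q; rewrite /heat_term -/k.
have wp := sqr_ge0 (1 + Num.sqrt (mu q)).
have mq := eigenval_ge0 E q.
have e1 : expR (- (2 * k * t)) = expR (- (2 * k * s)) * expR (- (2 * k * (t - s))).
  by rewrite -expRD; congr expR; lra.
have e2 := expR_ge1Dx (- (2 * k * (t - s))).
have e3 : expR (- (2 * k * s)) <= expR (- (2 * k * a)).
  by rewrite ler_expR lerN2 ler_wpM2l// mulr_ge0.
have x0 := expR_ge0 (- (2 * k * s)).
have ts : 0 <= t - s by rewrite subr_ge0.
rewrite e1; move: x0 e2 e3; set X := expR (- (2 * k * s)); set A := expR (- (2 * k * a)).
set Y := expR (- (2 * k * (t - s))) => x0 e2 e3.
have h1 : X - X * Y <= A * (2 * k * (t - s)).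
  apply: (@le_trans _ _ (X * (2 * k * (t - s)))).
    by rewrite -[X in X - _]mulr1 -mulrBr ler_wpM2l//; lra.
  by rewrite ler_wpM2r// !mulr_ge0.
have A0 : 0 <= A := le_trans x0 e3.
have h2 : A * (2 * k * (t - s)) * (1 + Num.sqrt (mu q)) ^+ 2 <=
   A * (2 * (1 + mu q) * (t - s)) * (2 * (1 + mu q)).
  apply: ler_pM => //; first by rewrite !mulr_ge0.
  by rewrite ler_wpM2l// ler_wpM2r// ler_wpM2l.
have h3 : (X - X * Y) * (1 + Num.sqrt (mu q)) ^+ 2 <= A * (2 * k * (t - s)) * (1 + Num.sqrt (mu q)) ^+ 2.
  by rewrite ler_wpM2r.
move: h2 h3; move: (t - s) ((1 + Num.sqrt (mu q)) ^+ 2) (mu q) => d W m; lra.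
Qed.

Lemma heat_sum_continuous (a b : R) : 0 < a -> {within `[a, b], continuous S}.
Proof.
move=> a0; have [L L0 LP] := heat_sum_lipschitz a0.
apply/subspace_continuousP => s /=; rewrite in_itv/= => /andP[as_ sb].
apply/cvgrPdist_lt => eps eps0; rewrite near_withinE.
have L1 : 0 < L + 1 by rewrite ltr_wpDl.
near=> t; rewrite /= in_itv/= => /andP[at_ tb].
have d : `|s - t| < eps / (L + 1).
  by near: t; apply: (@cvgr_dist_lt _ _ _ (nbhs s) _ idfun s) => //; rewrite divr_gt0.
have {}d : `|s - t| * (L + 1) < eps by rewrite -ltr_pdivlMr.
apply: le_lt_trans d.
have dec x y : a <= x -> x <= y -> S y <= S x.
  move=> ax; rewrite le_eqVlt => /predU1P[->//|xy].
  by apply: ltW; apply: heat_sum_ltr => //; exact: lt_le_trans ax.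
have [st|/ltW ts] := leP s t.
- rewrite [leLHS]ger0_norm ?subr_ge0 ?dec// ler0_norm ?subr_le0//.
  change (S s - S t <= - (s - t) * (L + 1)).
  have := LP s t as_ st; move: (S s) (S t) => x y; lra.
- rewrite [leLHS]ler0_norm ?subr_le0 ?dec// ger0_norm ?subr_ge0//.
  change (- (S s - S t) <= (s - t) * (L + 1)).
  have := LP t s at_ ts; move: (S s) (S t) => x y; lra.
Unshelve. all: by end_near. Qed.

Lemma heat_sum_large c : exists2 a, 0 < a & c <= S a.
Proof.
(* At time 1 / (2 (mu_n - mu_0)) each of the first n terms is at least exp(-1), so n >= |c| e makes
   their sum reach c. *)
pose n := (Num.bound (`|c| * expR 1)).+1.
have kn := gap_gt0 (ltn0Sn n.-1 : (0 < n)%N).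
have k20 : 0 < 2 * (mu n - mu 0%N) by rewrite mulr_gt0.
exists (2 * (mu n - mu 0%N))^-1; first by rewrite invr_gt0.
have a0 : 0 < (2 * (mu n - mu 0%N))^-1 by rewrite invr_gt0.
apply: le_trans (heat_partial_le n.+1 a0).
apply: (@le_trans _ _ (\sum_(1 <= q < n.+1) expR (-1))).
  rewrite sumr_const_nat subn1 /= -mulr_natl expRN ler_pdivlMr ?expR_gt0//.
  apply: (@le_trans _ _ (`|c| * expR 1)); first by rewrite ler_wpM2r ?expR_ge0 ?ler_norm.
  apply: ltW; apply: lt_le_trans (archi_boundP _) _; first by rewrite mulr_ge0 ?expR_ge0.
  by rewrite ler_nat.
rewrite big_nat [leRHS]big_nat; apply: ler_sum => q /andP[q1 qn].
rewrite /heat_term -[leLHS]mulr1; apply: ler_pM => //.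
  rewrite ler_expR lerN2 ler_pdivrMr// mul1r ler_wpM2l// lerD2r.
  by apply: (eigenval_homo E); rewrite -ltnS.
by rewrite -[leLHS](expr1n _ 2) lerXn2r ?nnegrE ?lerDl ?sqrtr_ge0// addr_ge0 ?sqrtr_ge0.
Qed.

Lemma heat_sum_small c : 0 < c -> exists2 b, 1 <= b & S b <= c.
Proof.
move=> c0; have k0 : 0 < 2 * (mu 1%N - mu 0%N) by rewrite mulr_gt0 ?gap_gt0.
have S0 := heat_sum_gt0 ltr01.
have p : 0 < c * (2 * (mu 1%N - mu 0%N)) by rewrite mulr_gt0.
(* This time makes the decay exponent counted from time 1 equal to y = S 1 / c, and exp(- y) <= 1 /
   y brings the sum below c. *)
have h : 1 <= 1 + S 1 / (c * (2 * (mu 1%N - mu 0%N))).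
  by rewrite lerDl divr_ge0 ?ltW.
exists (1 + S 1 / (c * (2 * (mu 1%N - mu 0%N)))) => //.
apply: (le_trans (heat_sum_decay ltr01 h)).
rewrite addrAC subrr add0r expRN mulrC ler_pdivrMr ?expR_gt0//.
have -> : 2 * (mu 1%N - mu 0%N) * (S 1 / (c * (2 * (mu 1%N - mu 0%N)))) = S 1 / c.
  by rewrite invfM mulrCA (mulrCA _ c^-1) divff ?mulr1// gt_eqF.
rewrite mulrC -ler_pdivrMr// (le_trans _ (expR_ge1Dx _))// ler_wpDl//.
Qed.

Lemma h5_surjective c : 0 < c -> exists2 tau, 0 < tau & h5 mu tau = c.
Proof.
move=> c0; have c20 : 0 < c ^+ 2 by rewrite exprn_gt0.
have [a a0 ha] := heat_sum_large (c ^+ 2); have [b b1 hb] := heat_sum_small c20.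
pose b' := Num.max a b; have ab : a <= b' by rewrite le_max lexx.
have b0 : 0 < b by apply: lt_le_trans b1.
have hb' : S b' <= c ^+ 2.
  have : b <= b' by rewrite le_max lexx orbT.
  rewrite le_eqVlt => /predU1P[<-//|bb']; apply: le_trans hb.
  exact: (ltW (heat_sum_ltr b0 bb')).
have [|tau tauab tauE] := IVT (v := c ^+ 2) ab (heat_sum_continuous (b := b') a0).
  by rewrite ge_min hb' orbT le_max ha.
exists tau; first by move: tauab; rewrite in_itv/= => /andP[/(lt_le_trans a0)].
by rewrite h5E tauE sqrtr_sqr ger0_norm// ltW.
Qed.

(** Surjectivity of [h5] makes the set under [xget] nonempty, so the default is not returned; strict
    decrease then gives the inequality beyond the threshold. For a zero defect the threshold is 0
    and the inequality is immediate. *)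
Lemma koopman_timeP u0 t : 0 <= koopman_defect e u0 -> 0 < m0 e ->
  koopman_time mu e u0 < t ->
  0 < t /\ koopman_defect e u0 * h5 mu t < m0 e ^+ 2.
Proof.
move=> d0 m00; rewrite /koopman_time; case: eqVneq => [-> t0|dn].
  by rewrite mul0r exprn_gt0.
have dp : 0 < koopman_defect e u0 by rewrite lt_def dn.
have c0 : 0 < m0 e ^+ 2 / koopman_defect e u0 by rewrite divr_gt0// exprn_gt0.
have [tau0 tau00 tau0E] := h5_surjective c0.
case: xgetP => [tau _ [tau_gt0 tauE] taut|/(_ tau0)]; last by move/not_andP => [].
have t0 := lt_trans tau_gt0 taut.
split => //; rewrite mulrC -ltr_pdivlMr// -tauE.
exact: h5_ltr.
Qed.

(** Origin of [h5]: Cauchy-Schwarz separates |c_q| from the exponential times 1 + sqrt mu_q, and the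
    squares of the latter are the terms of h5(t)^2. *)
Lemma weighted_coef_sum (v : R -> R) t n : L2 v -> 0 < t ->
  \sum_(1 <= q < n) expR (- ((mu q - mu 0%N) * t)) * `|coef e q v| * (1 + Num.sqrt (mu q)) <=
  L2norm (fun x => v x - coef e 0 v * e 0%N x) * h5 mu t.
Proof.
move=> lv t0; set N := L2norm _.
have N0 : 0 <= N := L2norm_ge0 _.
have w0 q : 0 <= 1 + Num.sqrt (mu q) by rewrite addr_ge0 ?sqrtr_ge0.
rewrite -ler_sqr ?nnegrE; last 2 first.
- by apply: sumr_ge0 => q _; rewrite !mulr_ge0 ?expR_ge0.
- by rewrite mulr_ge0 ?sqrtr_ge0.
rewrite exprMn h5_sqr//.
have -> : \sum_(1 <= q < n) expR (- ((mu q - mu 0%N) * t)) * `|coef e q v| * (1 + Num.sqrt (mu q)) =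
  \sum_(1 <= q < n) `|coef e q v| * (expR (- ((mu q - mu 0%N) * t)) * (1 + Num.sqrt (mu q))).
  by apply: eq_bigr => q _; rewrite mulrCA mulrA mulrC mulrA mulrC.
apply: (le_trans (cauchy_schwarz_seq _ _ _)); apply: ler_pM.
- by apply: sumr_ge0 => q _; exact: sqr_ge0.
- by apply: sumr_ge0 => q _; exact: sqr_ge0.
- apply: le_trans (sum_coef_sqr E n lv).
  by apply: ler_sum => q _; rewrite real_normK// num_real.
- apply: le_trans (heat_partial_le n t0).
  apply: ler_sum => q _; rewrite exprMn /heat_term -expRM_natl.
  by rewrite le_eqVlt; apply/orP; left; apply/eqP; congr (expR _ * _); rewrite mulr_natl; lra.
Qed.

End HeatSeries.

(** * The Koopman decomposition *)

Lemma prod_opp_seq {R : comRingType} (s : seq nat) (g : nat -> R) :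
  \prod_(q <- s) - g q = (-1) ^+ size s * \prod_(q <- s) g q.
Proof.
elim: s => [|q s ih] /=; first by rewrite !big_nil expr0 mulr1.
by rewrite !big_cons ih exprS mulN1r !mulNr mulrCA.
Qed.

Section Decomposition.
Context {R : realType}.
Variables (V : R -> R) (mu : nat -> R) (e : nat -> R -> R).
Hypothesis smoothV : smooth01 V.
Hypothesis V_gt0 : forall x, I01 x -> 0 < V x.
Hypothesis E : neumann_eigensystem V mu e.

Section FixedTime.
Variables (u0 : R -> R) (t : R).
Hypothesis Lu0 : L2 u0.
Hypothesis t_gt0 : 0 < t.
Hypothesis small : koopman_defect e u0 * h5 mu t < m0 e ^+ 2.

Let H := cole_hopf u0.
Let c0 := coef e 0 H.
Let A q := expR (- ((mu q - mu 0%N) * t)) * (coef e q H / c0).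

Let LH : L2 H. Proof. exact: continuous01_L2 (cole_hopf_continuous Lu0). Qed.

Let m0_gt0 : 0 < m0 e. Proof. exact: (m0_gt0_le E).1. Qed.

Let m0_le x : I01 x -> m0 e <= e 0%N x. Proof. exact: (m0_gt0_le E).2. Qed.

Let m0_le_c0 : m0 e <= c0. Proof. exact: (m0_le_coef0_cole_hopf E Lu0). Qed.

Let c0_gt0 : 0 < c0. Proof. exact: lt_le_trans m0_gt0 m0_le_c0. Qed.

Lemma koopman_weightE nu :
  expR (- (koopman_lambda mu nu * t)) * koopman_phi e nu u0 =
  \prod_(q <- nu.1 :: nu.2) A q.
Proof.
rewrite /koopman_lambda mulr_suml -sumrN expR_sum /koopman_phi -big_split /=.
by [].
Qed.

(** Weights of a head and of a letter. The sign (-1)^(m+1) of the mode is shared out, one factor -1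
    to the head and one to each letter. *)
Let d x q := - 2 * (A q * (derive01 (e q) x / e 0%N x)).
Let f x q := - (A q * (e q x / e 0%N x)).

Lemma koopman_termE nu x :
  expR (- (koopman_lambda mu nu * t)) * koopman_phi e nu u0 * koopman_mode e nu x
  = d x nu.1 * \prod_(q <- nu.2) f x q.
Proof.
rewrite koopman_weightE big_cons /koopman_mode /d /f prod_opp_seq.
have -> : \prod_(q <- nu.2) (A q * (e q x / e 0%N x)) =
    \prod_(q <- nu.2) A q * \prod_(q <- nu.2) (e q x / e 0%N x) by exact: big_split.
rewrite exprS; lra.
Qed.

Lemma norm_koopman_weight q : `|A q| = expR (- ((mu q - mu 0%N) * t)) * (`|coef e q H| / c0).
Proof. by rewrite normrM ger0_norm ?expR_ge0// normrM [`|c0^-1|]gtr0_norm ?invr_gt0. Qed.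

Let bf q := `|A q| * ((1 + Num.sqrt (mu q)) / m0 e).

Let rho := koopman_defect e u0 * h5 mu t / m0 e ^+ 2.

Lemma rho_lt1 : rho < 1.
Proof. by rewrite /rho ltr_pdivrMr ?mul1r// exprn_gt0. Qed.

Lemma ground_inv_le x : I01 x -> 0 < e 0%N x /\ (e 0%N x)^-1 <= (m0 e)^-1.
Proof.
move=> Ix; have e0 : 0 < e 0%N x by exact: lt_le_trans (m0_le Ix).
by split => //; rewrite lef_pV2 ?posrE// m0_le.
Qed.

Lemma koopman_ratio_le x q : I01 x -> `|f x q| <= bf q.
Proof.
move=> Ix; have [e0 ei] := ground_inv_le Ix.
rewrite normrN normrM ler_wpM2l// normrM [`|_^-1|]gtr0_norm ?invr_gt0//.
apply: ler_pM => //; first by rewrite invr_ge0 ltW.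
exact: (eigenfun_sup smoothV V_gt0 E).
Qed.

(** Of the two factors 1 / m_0, one comes from 1 / c_0 and the other from 1 / e_0(x). *)
Lemma koopman_ratio_sum N : \sum_(q <- iota 1 N) bf q <= rho.
Proof.
have -> : \sum_(q <- iota 1 N) bf q = (c0 * m0 e)^-1 *
    \sum_(1 <= q < N.+1) expR (- ((mu q - mu 0%N) * t)) * `|coef e q H| * (1 + Num.sqrt (mu q)).
  rewrite mulr_sumr /index_iota subn1 /=; apply: eq_bigr => q _.
  rewrite /bf norm_koopman_weight invfM.
  by move: (expR _) `|coef e q H| (1 + _) c0^-1 (m0 e)^-1 => a b k i j; lra.
have k0 : 0 <= koopman_defect e u0 * h5 mu t by rewrite mulr_ge0 ?L2norm_ge0 ?sqrtr_ge0.
apply: (@le_trans _ _ ((c0 * m0 e)^-1 * (koopman_defect e u0 * h5 mu t))).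
  apply: ler_wpM2l; first by rewrite invr_ge0 mulr_ge0 ?ltW.
  exact: (weighted_coef_sum smoothV V_gt0 E).
rewrite mulrC /rho ler_wpM2l// lef_pV2 ?posrE ?mulr_gt0 ?exprn_gt0//.
by rewrite expr2 ler_wpM2r// ltW.
Qed.

(** Heads need no smallness: |c_q| <= |H|_2 and the bound on e_q' leave a heat moment, finite for
    every t > 0. The majorant is uniform in x, as the sup norm demands. *)
Lemma koopman_head_bound : exists2 bd : nat -> R,
  (forall x q, I01 x -> `|d x q| <= bd q) &
  exists K, forall N, \sum_(q < N) bd q <= K.
Proof.
have [K K0 eK] := eigenfun_derive_sup smoothV E.
have [M M0 MP] := eigenval_heat_moment smoothV V_gt0 E t_gt0.
have NH := L2norm_ge0 H.
pose C := 2 * (expR (mu 0%N * t) * (L2norm H / c0) * (K / m0 e)).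
have C0 : 0 <= C.
  by rewrite /C; do !apply: mulr_ge0 => //; rewrite ?expR_ge0 ?invr_ge0 ?ltW.
exists (fun q => C * ((1 + mu q) ^+ 2 * expR (- (t * mu q)))); last first.
  by exists (C * M) => N; rewrite -mulr_sumr ler_wpM2l.
move=> x q Ix; have [e0 ei] := ground_inv_le Ix.
have mq := eigenval_ge0 E q.
have hc : `|coef e q H| <= L2norm H.
  have := cauchy_schwarz01 (eigenfun_L2 E q) LH.
  by rewrite (eigenfun_L2norm E) mul1r.
(* The exponent 2, weaker than what the bound on e_q' gives, matches [eigenval_heat_moment]. *)
have h1 : `|derive01 (e q) x / e 0%N x| <= K * (1 + mu q) ^+ 2 / m0 e.
  rewrite normrM [`|_^-1|]gtr0_norm ?invr_gt0//.
  apply: ler_pM => //; first by rewrite invr_ge0 ltW.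
  apply: (le_trans (eK q x Ix)); rewrite ler_wpM2l ?ltW//.
  by move: (mu q) mq => m mq; nra.
have h2 : `|A q| <= expR (mu 0%N * t) * expR (- (t * mu q)) * (L2norm H / c0).
  rewrite norm_koopman_weight -expRD; apply: ler_pM; rewrite ?expR_ge0//.
  - by rewrite divr_ge0// ltW.
  - by rewrite ler_expR le_eqVlt; apply/orP; left; apply/eqP; lra.
  - by rewrite ler_wpM2r// invr_ge0 ltW.
rewrite /d normrM normrN [`|2|]ger0_norm// normrM.
have := ler_pM (normr_ge0 _) (normr_ge0 _) h2 h1; rewrite /C.
move: `|A q| `|_ / _| (expR _) (expR _) (1 + mu q) (L2norm H) c0^-1 (m0 e)^-1.
by move=> a b k l m n i j; lra.
Qed.

Lemma koopman_abs_cvg_small : koopman_abs_cvg mu e u0 t.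
Proof.
have [bd dbd [K bdK]] := koopman_head_bound.
have r1 := rho_lt1.
(* The majorants do not depend on x; the point 0 serves to know that they are nonnegative. *)
have dI0 q := dbd 0 q I01_0.
have fI0 q (_ : (0 < q)%N) := koopman_ratio_le q I01_0.
have bsum := koopman_bound_sum dI0 fI0 bdK koopman_ratio_sum r1.
apply: (esum_lty bsum) => nu nuI.
have w0 : 0 <= expR (- (koopman_lambda mu nu * t)) * `|koopman_phi e nu u0|.
  by rewrite mulr_ge0 ?expR_ge0.
set w := expR _ * _ in w0 *.
set b := bd nu.1 * _.
have wb x : I01 x -> w * `|koopman_mode e nu x| <= b.
  move=> Ix.
  have := koopman_term_le (fun q => dbd x q Ix) (fun q _ => koopman_ratio_le q Ix) nuI.
  by rewrite -koopman_termE !normrM [`|expR _|]ger0_norm ?expR_ge0.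
have sup0 : (0 <= ereal_sup [set (`|koopman_mode e nu x|)%:E | x in I01])%E.
  apply: (@le_trans _ _ (`|koopman_mode e nu 0|)%:E); first by rewrite lee_fin.
  by apply: ereal_sup_ubound; exists 0 => //; exact: I01_0.
apply/andP; split; first by rewrite mule_ge0.
(* The supremum is bounded by dividing by the weight, so weight 0 is separate: there the extended
   product is 0 whatever the supremum. *)
move: w0; rewrite le_eqVlt => /predU1P[w_0|w_gt0].
  rewrite -w_0 mul0e lee_fin.
  by have := wb 0 I01_0; rewrite -w_0 mul0r.
rewrite -lee_pdivlMl// -EFinM; apply: ub_ereal_sup => _ [x Ix <-].
by rewrite lee_fin mulrC ler_pdivlMr// mulrC wb.
Qed.

Lemma koopman_has_sum_small u x : burgers_solution V u0 u -> I01 x ->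
  has_sum koopman_index
    (fun nu => expR (- (koopman_lambda mu nu * t)) * koopman_phi e nu u0
                 * koopman_mode e nu x) (u t x).
Proof.
move=> S Ix; have [bd dbd [K bdK]] := koopman_head_bound.
have [e0 _] := ground_inv_le Ix.
have [p p0 [p1 p2]] := burgers_eigen_expansion smoothV E Lu0 S t_gt0 Ix.
have -> : (fun nu => expR (- (koopman_lambda mu nu * t)) * koopman_phi e nu u0
    * koopman_mode e nu x) = (fun nu => d x nu.1 * \prod_(q <- nu.2) f x q).
  by apply/funext => nu; exact: koopman_termE.
(* Mode 0 contributes exactly e_0 to the series with limit p, so the letters sum to 1 - p / e_0. *)
have A0 : A 0%N = 1.
  by rewrite /A subrr mul0r oppr0 expR0 mul1r divff// gt_eqF.
(* The heads sum to u p / e_0 and the geometric series to e_0 / p, so p cancels. *)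
have -> : u t x = (- 2 * (- (2^-1 * u t x) * p / e 0%N x)) /
    (1 - (- ((p - e 0%N x) / e 0%N x))).
  have -> : 1 - (- ((p - e 0%N x) / e 0%N x)) = p / e 0%N x.
    by rewrite mulrBl divff ?gt_eqF//; lra.
  have -> : - 2 * (- (2^-1 * u t x) * p / e 0%N x) = u t x * (p / e 0%N x) by lra.
  by rewrite mulfK// gt_eqF// divr_gt0.
apply: (koopman_has_sum (fun q => dbd x q Ix) (fun q _ => koopman_ratio_le q Ix) bdK koopman_ratio_sum rho_lt1).
- have -> : (fun N => \sum_(q < N) d x q) =
      (fun N => - 2 * (\sum_(q < N) A q * derive01 (e q) x / e 0%N x)).
    by apply/funext => N; rewrite mulr_sumr; apply: eq_bigr => q _; rewrite /d mulrA.
  apply: cvgM; first exact: cvg_cst.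
  under eq_fun do rewrite -mulr_suml.
  by apply: cvgM; [exact: p2|exact: cvg_cst].
- have -> : (fun N => \sum_(q <- iota 1 N) f x q) =
      (fun N => - ((\sum_(q < N.+1) A q * e q x - e 0%N x) / e 0%N x)).
    apply/funext => N; rewrite -(big_mkord xpredT (fun q => A q * e q x)) big_ltn//.
    rewrite A0 mul1r addrAC subrr add0r mulr_suml -sumrN /index_iota subn1 /=.
    by apply: eq_bigr => q _; rewrite /f mulrA.
  apply: cvgN; apply: cvgM; last exact: cvg_cst.
  apply: cvgB; last exact: cvg_cst.
  by move: p1; rewrite -(cvg_shiftS (fun N => \sum_(q < N) A q * e q x)).
Qed.

Lemma koopman_decomposition_small : koopman_decomposition V mu e u0 t.
Proof.
by split => [|u S x Ix]; [exact: koopman_abs_cvg_small|exact: koopman_has_sum_small].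
Qed.

End FixedTime.

(** * The neighbourhood of [s0] *)

Lemma s0_continuous : continuous01 (s0 e).
Proof.
have ci : continuous01 (fun x => (e 0%N x)^-1).
  apply: continuous01V; first exact: (eigenfun_continuous E).
  by move=> x Ix; rewrite gt_eqF// (eigenfun0_gt0 E).
by apply: continuous01M => //; apply: continuous01Z; exact: (eigenfun_derive_continuous E).
Qed.

Lemma s0_L2 : L2 (s0 e).
Proof. exact: continuous01_L2 s0_continuous. Qed.

(* [e_0 exp(1/2 int_0^x s0)] has zero derivative. *)
Lemma cole_hopf_num_s0 x : I01 x -> e 0%N x = e 0%N 0 * cole_hopf_num (s0 e) x.
Proof.
move=> Ix; pose g y := e 0%N y * expR (2^-1 * primitive (s0 e) y).
have dg y : I01 y -> has_derive01 g y 0.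
  move=> Iy; have e0 := eigenfun0_gt0 E Iy.
  have -> : 0 = derive01 (e 0%N) y * expR (2^-1 * primitive (s0 e) y) +
      e 0%N y * (expR (2^-1 * primitive (s0 e) y) * (2^-1 * s0 e y)).
    have -> : 2^-1 * s0 e y = - (derive01 (e 0%N) y / e 0%N y) by rewrite /s0; lra.
    move: (derive01 (e 0%N) y) (e 0%N y) (expR _) e0 => a b k b0.
    have -> : a * k + b * (k * - (a / b)) = a * k - (b / b) * (a * k) by lra.
    by rewrite divff ?gt_eqF// mul1r subrr.
  apply: has_derive01M; first exact: (eigenfun_has_derive E).
  apply: (@has_derive01_comp _ expR (fun y => 2^-1 * primitive (s0 e) y)).
  by apply: has_derive01Z; apply: has_derive01_primitive => //; exact: s0_continuous.
have d0 y (Iy : I01 y) : cst 0 y = derive01 g y.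
  by rewrite (has_derive01_unique Iy (dg y Iy)).
have := ftc01 (fun y Iy => has_derive01_derivable (dg y Iy))
  (eq_continuous01 d0 (@continuous01_cst R 0)) Ix.
rewrite -(eq_primitive Ix d0) {1}/primitive Rintegral_cst//= mul0r => /esym/eqP.
rewrite subr_eq0 /g primitive0 mulr0 expR0 mulr1 => /eqP <-.
by rewrite cole_hopf_numE -mulrA -expRD subrr expR0 mulr1.
Qed.

Lemma cole_hopf_s0 x : I01 x -> cole_hopf (s0 e) x = f0 e x.
Proof.
move=> Ix; have e00 := eigenfun0_gt0 E I01_0.
rewrite /f0 (eq_int01 cole_hopf_num_s0) int01Z; last first.
  exact: (continuous01_integrable (cole_hopf_num_continuous s0_L2)).
rewrite (cole_hopf_num_s0 Ix) invfM mulrACA divff ?mul1r// gt_eqF//.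
Qed.

Lemma f0_L2 : L2 (f0 e).
Proof.
have := L2Z (int01 (e 0%N))^-1 (eigenfun_L2 E 0%N).
by under eq_fun do rewrite mulrC.
Qed.

Lemma koopman_defect_le u0 : L2 u0 ->
  koopman_defect e u0 <= L2norm (cole_hopf u0 \- f0 e).
Proof.
move=> lu; have lH := continuous01_L2 (cole_hopf_continuous lu).
apply: le_trans (sub_ground_le E (int01 (e 0%N))^-1 lH) _.
by rewrite le_eqVlt; apply/orP; left; apply/eqP/eq_L2norm => x _ /=; rewrite /f0 mulrC.
Qed.

Lemma koopman_domain_neighbourhood theta0 : 0 < theta0 ->
  L2_neighbourhood (s0 e) (koopman_domain mu e theta0).
Proof.
move=> th0; split; first exact: s0_L2.
pose r := m0 e ^+ 2 / h5 mu theta0.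
have r0 : 0 < r.
  by rewrite divr_gt0 ?exprn_gt0 ?(m0_gt0_le E).1// (h5_gt0 smoothV V_gt0 E).
pose N := L2norm (f0 e); have N0 : 0 <= N := L2norm_ge0 _.
have N1 : 0 < N + 1 by rewrite ltr_wpDl.
have k0 : 0 < r / (N + 1) by rewrite divr_gt0.
(* Chosen so that (exp delta - 1) (N + 1) = r, where (exp D - 1) N bounds the distance from H(v) to
   [f0]; with N + 1 there is no need to know that N is nonzero. *)
exists (ln (1 + r / (N + 1))); first by rewrite ln_gt0// ltrDl.
move=> v lv vd; split => //; rewrite -/r.
have ls := s0_L2.
have lH := continuous01_L2 (cole_hopf_continuous lv).
set D := L2norm (v \- s0 e) in vd.
have eD : expR D < 1 + r / (N + 1).
  by rewrite -[ltRHS]lnK ?ltr_expR// posrE addr_gt0.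
have D1 : 0 <= expR D - 1 by rewrite subr_ge0 -expR0 ler_expR L2norm_ge0.
apply: (@le_lt_trans _ _ ((expR D - 1) * N)).
  rewrite -[X in X * _](ger0_norm D1) -(L2normZ _ f0_L2).
  apply: (L2norm_le_pointwise (L2B lH f0_L2) (L2Z _ f0_L2)) => x Ix.
  rewrite -(cole_hopf_s0 Ix) (le_trans (cole_hopf_dist ls lv Ix))//.
  by rewrite mulrC ler_norm.
have : (expR D - 1) * (N + 1) < r by rewrite -ltr_pdivlMr//; lra.
by apply: le_lt_trans; rewrite ler_wpM2l// lerDl.
Qed.

(** Smallness is verified directly at time t: the projection bound controls the defect by the
    distance to [f0], and [h5] decreases after theta0. *)
Lemma koopman_domain_decomposition theta0 u0 t : 0 < theta0 ->
  koopman_domain mu e theta0 u0 -> theta0 < t -> koopman_decomposition V mu e u0 t.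
Proof.
move=> th0 [lu ud] tt; have t0 := lt_trans th0 tt.
apply: koopman_decomposition_small => //.
have hp := h5_gt0 smoothV V_gt0 E th0.
rewrite ltr_pdivlMr// in ud; apply: le_lt_trans ud.
apply: ler_pM; [exact: L2norm_ge0|exact: sqrtr_ge0|exact: koopman_defect_le|].
exact: (ltW (h5_ltr smoothV V_gt0 E th0 tt)).
Qed.

End Decomposition.

Theorem mainTheorem3 (R : realType) (V : R -> R) (mu : nat -> R)
    (e : nat -> R -> R) :
  smooth01 V -> (forall x, I01 x -> 0 < V x) -> neumann_eigensystem V mu e ->
  (forall u0, L2 u0 -> forall t : R, koopman_time mu e u0 < t ->
     koopman_decomposition V mu e u0 t) /\
  (forall theta0 : R, 0 < theta0 ->
     L2_neighbourhood (s0 e) (koopman_domain mu e theta0) /\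
     forall u0, koopman_domain mu e theta0 u0 -> forall t : R, theta0 < t ->
       koopman_decomposition V mu e u0 t).
Proof.
move=> sV V0 E; split.
  move=> u0 lu t ht.
  have [t0 h] := koopman_timeP sV V0 E (L2norm_ge0 _) (m0_gt0_le E).1 ht.
  exact: koopman_decomposition_small.
move=> theta0 th0; split; first exact: (koopman_domain_neighbourhood sV V0 E).
move=> u0 hu t; exact: (koopman_domain_decomposition sV V0 E th0 hu).
Qed.
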